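(* Let $(\Omega,\mu)$ be a measure space with the direct sum property, and let $\mathcal L^1$ and $\mathcal L^\infty$ denote the spaces of (classes of) real-valued integrable, respectively essentially bounded, functions on $\Omega$. Then for every absolute contraction $T:\mathcal L^1\to\mathcal L^1$ there exists a unique Dunford-Schwartz operator $S:\mathcal L^1+\mathcal L^\infty\to\mathcal L^1+\mathcal L^\infty$ such that $S|_{\mathcal L^1}=T$ and $S|_{\mathcal L^\infty}$ is $\sigma(\mathcal L^\infty,\mathcal L^1)$-continuous.
   Context: A complete measure space $(\Omega,\mathcal A,\mu)$ is semifinite if every (measurable) subset of $\Omega$ of non-zero measure admits a (measurable) subset of finite non-zero measure. A semifinite measure space $(\Omega,\mathcal A,\mu)$ has the direct sum property if the Boolean algebra $\mathcal A/\!\sim$ of equivalence classes of measurable sets (modulo null sets) is complete, i.e. every subset of it has a least upper bound. All function spaces here are real. A linear operator $T:\mathcal L^1\to\mathcal L^1$ is an absolute contraction if $\|T(f)\|_1\le\|f\|_1$ for all $f\in\mathcal L^1$ and $\|T(f)\|_\infty\le\|f\|_\infty$ for all $f\in\mathcal L^1\cap\mathcal L^\infty$. A linear operator $S:\mathcal L^1+\mathcal L^\infty\to\mathcal L^1+\mathcal L^\infty$ is a Dunford-Schwartz operator if $\|S(f)\|_1\le\|f\|_1$ for all $f\in\mathcal L^1$ and $\|S(f)\|_\infty\le\|f\|_\infty$ for all $f\in\mathcal L^\infty$. $\sigma(\mathcal L^\infty,\mathcal L^1)$ is the weak topology on $\mathcal L^\infty$ induced by the pairing $(f,g)\mapsto\int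 fg\,d\mu$, $f\in\mathcal L^\infty$, $g\in\mathcal L^1$; continuity of $S|_{\mathcal L^\infty}:\mathcal L^\infty\to\mathcal L^\infty$ is with respect to this topology on both sides. *)

(* Defs.v *)
From HB Require Import structures.
From mathcomp Require Import all_boot all_order all_algebra.
From mathcomp Require Import all_classical all_reals all_analysis.
(* Not re-exported by [all_analysis]. *)
From mathcomp Require Import ess_sup_inf measurable_realfun.

Set Implicit Arguments.
Unset Strict Implicit.
Unset Printing Implicit Defensive.

Import Order.TTheory GRing.Theory Num.Theory.
Import numFieldNormedType.Exports.

Local Open Scope classical_set_scope.
Local Open Scope ring_scope.
Local Open Scope quotient_scope.

(* The measure algebra of [mu]: measurable sets modulo null sets. *)
Section MeasureAlgebra.
Context d (T : measurableType d) (R : realType).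
Variable mu : {measure set T -> \bar R}.

Definition measurable_set := {A : set T | A \in @measurable d T}.
HB.instance Definition _ := Choice.on measurable_set.

Lemma measurable_setP (A : measurable_set) : measurable (val A).
Proof. by have := valP A; rewrite inE. Qed.

Definition eq_mod_null (A B : measurable_set) : bool :=
  mu (val A `+` val B) == 0%E.

Definition sub_mod_null (A B : measurable_set) : bool :=
  mu (val A `\` val B) == 0%E.

Lemma eq_mod_nullE A B :
  eq_mod_null A B = sub_mod_null A B && sub_mod_null B A.
Proof.
have mA := measurable_setP A; have mB := measurable_setP B.
rewrite /eq_mod_null /sub_mod_null measureU; last 3 first.
- exact: measurableD.
- exact: measurableD.
- by apply/seteqP; split => x //= [[Ax nBx] [Bx nAx]].
by rewrite padde_eq0.
Qed.

Lemma sub_mod_null_refl : reflexive sub_mod_null.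
Proof. by move=> A; rewrite /sub_mod_null setDv measure0. Qed.

Lemma sub_mod_null_trans : transitive sub_mod_null.
Proof.
move=> B A C /eqP AB /eqP BC; apply/eqP.
have mA := measurable_setP A; have mB := measurable_setP B.
have mC := measurable_setP C.
apply/eqP; rewrite -measure_le0.
apply: (@le_trans _ _ (mu ((val A `\` val B) `|` (val B `\` val C)))).
  apply: le_measure; rewrite ?inE; [exact: measurableD| |].
    by apply: measurableU; exact: measurableD.
  move=> x [Ax nCx]; have [Bx|nBx] := pselect (val B x); last by left.
  by right.
rewrite (le_trans (measureU2 _ _ _))//; [exact: measurableD..|].
by rewrite [X in (X + _ <= _)%E]AB [X in (_ + X <= _)%E]BC adde0.
Qed.

Lemma eq_mod_null_refl : reflexive eq_mod_null.
Proof. by move=> A; rewrite eq_mod_nullE sub_mod_null_refl. Qed.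

Lemma eq_mod_null_sym : symmetric eq_mod_null.
Proof. by move=> A B; rewrite !eq_mod_nullE andbC. Qed.

Lemma eq_mod_null_trans : transitive eq_mod_null.
Proof.
move=> B A C; rewrite !eq_mod_nullE => /andP[AB BA] /andP[BC CB].
by rewrite (sub_mod_null_trans AB BC) (sub_mod_null_trans CB BA).
Qed.

Canonical eq_mod_null_equiv :=
  EquivRel eq_mod_null eq_mod_null_refl eq_mod_null_sym eq_mod_null_trans.

Definition measure_algebra : Type := {eq_quot eq_mod_null}.
HB.instance Definition _ := Choice.on measure_algebra.
HB.instance Definition _ := EqQuotient.on measure_algebra.

(* The order of the Boolean algebra: inclusion up to a null set
   (see [measure_algebra_leE]). *)
Definition measure_algebra_le (a b : measure_algebra) : bool :=
  sub_mod_null (repr a) (repr b).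

Lemma measure_algebra_le_refl : reflexive measure_algebra_le.
Proof. by move=> a; exact: sub_mod_null_refl. Qed.

Lemma measure_algebra_le_anti : antisymmetric measure_algebra_le.
Proof.
move=> a b; rewrite /measure_algebra_le -eq_mod_nullE => ab.
by rewrite -[a]reprK -[b]reprK; apply/eqP; rewrite eqmodE.
Qed.

Lemma measure_algebra_le_trans : transitive measure_algebra_le.
Proof. by move=> b a c; exact: sub_mod_null_trans. Qed.

Fact measure_algebra_display : Order.disp_t. Proof. exact. Qed.

HB.instance Definition _ := Order.Le_isPOrder.Build measure_algebra_display
  measure_algebra measure_algebra_le_refl measure_algebra_le_anti
  measure_algebra_le_trans.

Lemma measure_algebra_leE (A B : measurable_set) :
  (\pi_measure_algebra A <= \pi_measure_algebra B)%O = sub_mod_null A B.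
Proof.
have reprP (C : measurable_set) : eq_mod_null (repr (\pi_measure_algebra C)) C.
  have /eqP : repr (\pi_measure_algebra C) = C %[mod measure_algebra].
    by rewrite reprK.
  by rewrite eqmodE.
move: (reprP A) (reprP B); rewrite !eq_mod_nullE.
move=> /andP[rA Ar] /andP[rB Br]; apply/idP/idP => [le_rAB|AB].
  exact: sub_mod_null_trans Ar (sub_mod_null_trans le_rAB rB).
exact: sub_mod_null_trans rA (sub_mod_null_trans AB Br).
Qed.

Definition semifinite_measure := forall A : set T, measurable A ->
  mu A != 0%E ->
  exists B : set T, [/\ measurable B, B `<=` A, mu B != 0%E & (mu B < +oo)%E].

Definition direct_sum_property :=
  [/\ measure_is_complete mu, semifinite_measure &
      forall F : set measure_algebra, supremums F !=set0].

End MeasureAlgebra.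

(* The set L^0 of classes of measurable functions is a real vector space for the
   operations inherited from functions (see [L0_classD] and [L0_classZ]). *)
Section L0_lmodule.
Context d (T : measurableType d) (R : realType).
Variable mu : {measure set T -> \bar R}.

Local Notation L0 := {mfun_ mu, T >-> measurableTypeR R}.

(* [{mfun T >-> R}], which carries the vector space structure, and
   [{mfun T >-> measurableTypeR R}], on which the spaces [LspaceType] are
   built, only differ by the display of the Borel sigma-algebra of [R]. *)
Lemma mfunR_subproof (f : {mfun T >-> measurableTypeR R}) :
  (f : T -> R) \in @mfun _ _ T R.
Proof. by rewrite inE; exact: (@measurable_funPT _ _ _ _ f). Qed.
Definition mfunR (f : {mfun T >-> measurableTypeR R}) : {mfun T >-> R} :=
  mfun_Sub (mfunR_subproof f).

Lemma mfun_of_subproof (f : {mfun T >-> R}) :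
  (f : T -> measurableTypeR R) \in @mfun _ _ T (measurableTypeR R).
Proof. by rewrite inE; exact: (@measurable_funPT _ _ _ _ f). Qed.
Definition mfun_of (f : {mfun T >-> R}) : {mfun T >-> measurableTypeR R} :=
  mfun_Sub (mfun_of_subproof f).

Definition L0_class (f : {mfun T >-> R}) : L0 := \pi_L0 (mfun_of f).
Definition L0_repr (f : L0) : {mfun T >-> R} := mfunR (repr f).

Local Notation cl := L0_class.
Local Notation rp := L0_repr.

Lemma L0_reprK (f : L0) : cl (rp f) = f.
Proof.
rewrite -[RHS]reprK; congr (\pi_L0 _).
by apply/mfuneqP.
Qed.

Lemma L0_class_eqP (f g : {mfun T >-> R}) :
  cl f = cl g <-> (f = g %[ae mu]).
Proof.
by split=> [/eqP|fg]; [|apply/eqP]; rewrite eqmodE => *; apply/asboolP.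
Qed.

Lemma L0_repr_class (f : {mfun T >-> R}) : rp (cl f) = f %[ae mu].
Proof. by apply/L0_class_eqP; rewrite L0_reprK. Qed.

Definition L0_zero : L0 := cl 0.
Definition L0_opp (f : L0) : L0 := cl (- rp f).
Definition L0_add (f g : L0) : L0 := cl (rp f + rp g).
Definition L0_scale (a : R) (f : L0) : L0 := cl (a *: rp f).

Let pi_opp f : L0_opp (cl f) = cl (- f).
Proof.
apply/L0_class_eqP; have := L0_repr_class f.
by apply: filterS => x fx _; exact: (congr1 (@GRing.opp R) (fx I)).
Qed.

Let pi_add f g : L0_add (cl f) (cl g) = cl (f + g).
Proof.
apply/L0_class_eqP; have := L0_repr_class g; have := L0_repr_class f.
by apply: filterS2 => x fx gx _; exact: (congr2 (@GRing.add R) (fx I) (gx I)).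
Qed.

Let pi_scale a f : L0_scale a (cl f) = cl (a *: f).
Proof.
apply/L0_class_eqP; have := L0_repr_class f.
by apply: filterS => x fx _; exact: (congr1 (@GRing.mul R a) (fx I)).
Qed.

Lemma L0_addA : associative L0_add.
Proof.
by move=> f g h; rewrite -[f]L0_reprK -[g]L0_reprK -[h]L0_reprK !pi_add addrA.
Qed.

Lemma L0_addC : commutative L0_add.
Proof. by move=> f g; rewrite -[f]L0_reprK -[g]L0_reprK !pi_add addrC. Qed.

Lemma L0_add0 : left_id L0_zero L0_add.
Proof. by move=> f; rewrite -[f]L0_reprK pi_add add0r. Qed.

Lemma L0_addN : left_inverse L0_zero L0_opp L0_add.
Proof. by move=> f; rewrite -[f]L0_reprK pi_opp pi_add addNr. Qed.

HB.instance Definition _ := GRing.isZmodule.Build L0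
  L0_addA L0_addC L0_add0 L0_addN.

Lemma L0_classD (f g : {mfun T >-> R}) : cl (f + g) = cl f + cl g.
Proof. by rewrite -pi_add. Qed.

Lemma L0_scaleA a b f : L0_scale a (L0_scale b f) = L0_scale (a * b) f.
Proof. by rewrite -[f]L0_reprK !pi_scale scalerA. Qed.

Lemma L0_scale1 : left_id 1 L0_scale.
Proof. by move=> f; rewrite -[f]L0_reprK pi_scale scale1r. Qed.

Lemma L0_scaleDr : right_distributive L0_scale +%R.
Proof.
move=> a f g; rewrite -[f]L0_reprK -[g]L0_reprK -L0_classD !pi_scale.
by rewrite scalerDr L0_classD.
Qed.

Lemma L0_scaleDl f : {morph L0_scale^~ f : a b / a + b}.
Proof.
by move=> a b; rewrite -[f]L0_reprK !pi_scale scalerDl L0_classD.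
Qed.

HB.instance Definition _ := GRing.Zmodule_isLmodule.Build R L0
  L0_scaleA L0_scale1 L0_scaleDr L0_scaleDl.

Lemma L0_classZ (a : R) (f : {mfun T >-> R}) : cl (a *: f) = a *: cl f.
Proof. by rewrite -pi_scale. Qed.

End L0_lmodule.

Section Lspace_lmodule.
Context d (T : measurableType d) (R : realType).
Variable mu : {measure set T -> \bar R}.
Local Notation L0 := {mfun_ mu, T >-> measurableTypeR R}.

Lemma Lnorm_ae_eq (p : \bar R) (f g : {mfun T >-> R}) : f = g %[ae mu] ->
  ('N[mu]_p[EFin \o f] = 'N[mu]_p[EFin \o g])%E.
Proof.
move=> fg; rewrite unlock /Lnorm; case: p => [r| |].
- congr (_ `^ _)%E; apply: ge0_ae_eq_integral => //.
  + apply/measurable_EFinP.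
    apply: (@measurableT_comp _ _ _ _ _ _ (@powR R ^~ r)) => //.
    exact: measurableT_comp.
  + apply/measurable_EFinP.
    apply: (@measurableT_comp _ _ _ _ _ _ (@powR R ^~ r)) => //.
    exact: measurableT_comp.
  + by move=> x _; exact: poweR_ge0.
  + by move=> x _; exact: poweR_ge0.
  + by apply: filterS fg => x + Tx => /(_ Tx) /= ->.
- case: ifPn => // _; apply: eq_ess_sup.
  by apply: filterS fg => x /(_ I) /= ->.
- case: ifPn => // _; apply: eq_ess_inf.
  by apply: filterS fg => x /(_ I) /= ->.
Qed.

Section Lspace_sub.
Variables (p : \bar R) (p1 : (1 <= p)%E).

Definition Lspace_pred : {pred L0} := mem [set f : L0 | finite_norm mu p f].

Section Sub.
Context (f : L0) (fP : f \in Lspace_pred).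
Definition Lspace_Sub_subproof :=
  @isFinLebesgue.Build d T R mu p p1 f (set_mem fP).
#[local] HB.instance Definition _ := Lspace_Sub_subproof.
Definition Lspace_Sub : LspaceType mu p1 := f.
End Sub.

Lemma Lspace_rect (K : LspaceType mu p1 -> Type) :
  (forall f (Pf : f \in Lspace_pred), K (Lspace_Sub Pf)) -> forall u, K u.
Proof.
move=> Ksub [f [[Pf1]]].
have Pf : f \in Lspace_pred by rewrite inE.
have -> : Pf1 = set_mem Pf by [].
exact: Ksub.
Qed.

Lemma Lspace_valP f (Pf : f \in Lspace_pred) : Lspace_Sub Pf = f :> L0.
Proof. by []. Qed.

HB.instance Definition _ :=
  isSub.Build _ _ (LspaceType mu p1) Lspace_rect Lspace_valP.
HB.instance Definition _ := [Choice of LspaceType mu p1 by <:].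

Lemma Lspace_predE (f : {mfun T >-> R}) :
  (L0_class mu f \in Lspace_pred) = ((f : T -> R) \in Lfun mu p).
Proof.
have fE := Lnorm_ae_eq p (L0_repr_class mu f).
apply/idP/idP => [/set_mem fp|/andP[_ /set_mem fp]].
  apply/andP; split; first exact: mfunP.
  by apply/mem_set; rewrite /= /finite_norm -fE.
by apply/mem_set; rewrite /= /finite_norm fE.
Qed.

Lemma Lspace_submod_closed : submod_closed Lspace_pred.
Proof.
have [Lfun0 LfunD] := @Lfun_submod_closed d T R mu p p1; split.
  by rewrite -[0]/(L0_class mu 0) Lspace_predE.
move=> a f g; rewrite -[f]L0_reprK -[g]L0_reprK -L0_classZ -L0_classD.
by rewrite !Lspace_predE; exact: LfunD.
Qed.

HB.instance Definition _ := GRing.isSubmodClosed.Build _ _ Lspace_pred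
  Lspace_submod_closed.
HB.instance Definition _ :=
  [SubChoice_isSubLmodule of LspaceType mu p1 by <:].

End Lspace_sub.
End Lspace_lmodule.
Arguments Lspace_pred {d T R} mu p.

Notation Lspace1 mu := (LspaceType mu (lexx 1%E)).
Notation Lspaceoo mu := (LspaceType mu (leey 1%E)).

Section DunfordSchwartz.
Context d (T : measurableType d) (R : realType).
Variable mu : {measure set T -> \bar R}.
Local Notation L0 := {mfun_ mu, T >-> measurableTypeR R}.

Definition Lspace_sum_pred : {pred L0} :=
  mem [set f : L0 | exists (g : Lspace1 mu) (h : Lspaceoo mu),
                      f = (g : L0) + (h : L0)].

Lemma Lspace_sum_submod_closed : submod_closed Lspace_sum_pred.
Proof.
split; first by apply/mem_set; exists 0, 0; rewrite addr0.
move=> a _ _ /set_mem[g [h ->]] /set_mem[g' [h' ->]]; apply/mem_set.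
by exists (a *: g + g'), (a *: h + h'); rewrite /= scalerDr addrACA.
Qed.

HB.instance Definition _ := GRing.isSubmodClosed.Build _ _ Lspace_sum_pred
  Lspace_sum_submod_closed.

(* The space L^1 + L^oo, as a subspace of L^0. *)
Record Lspace_sum := LspaceSum {
  Lspace_sum_val :> L0 ;
  _ : Lspace_sum_val \in Lspace_sum_pred }.

HB.instance Definition _ := [isSub for Lspace_sum_val].
HB.instance Definition _ := [Choice of Lspace_sum by <:].
HB.instance Definition _ := [SubChoice_isSubLmodule of Lspace_sum by <:].

Lemma Lspace1_sum_subproof (f : Lspace1 mu) : (f : L0) \in Lspace_sum_pred.
Proof. by apply/mem_set; exists f, 0; rewrite addr0. Qed.
Definition Lspace1_sum (f : Lspace1 mu) : Lspace_sum :=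
  LspaceSum (Lspace1_sum_subproof f).

Lemma Lspaceoo_sum_subproof (f : Lspaceoo mu) : (f : L0) \in Lspace_sum_pred.
Proof. by apply/mem_set; exists 0, f; rewrite add0r. Qed.
Definition Lspaceoo_sum (f : Lspaceoo mu) : Lspace_sum :=
  LspaceSum (Lspaceoo_sum_subproof f).

(* The L^p-norm of a class, with value [+oo] outside of L^p. *)
Definition class_norm (p : \bar R) (f : L0) : \bar R :=
  'N[mu]_p[EFin \o (f : T -> R)]%E.

Definition absolute_contraction (S : {linear Lspace1 mu -> Lspace1 mu}) :=
  (forall f : Lspace1 mu, class_norm 1 (S f) <= class_norm 1 f)%E /\
  (forall f : Lspace1 mu, (f : L0) \in Lspace_pred mu +oo%E ->
     class_norm +oo (S f) <= class_norm +oo f)%E.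

Record dunford_schwartz := DunfordSchwartz {
  ds_op :> {linear Lspace_sum -> Lspace_sum} ;
  ds_norm1 : forall f : Lspace1 mu,
    (class_norm 1 (ds_op (Lspace1_sum f)) <= class_norm 1 f)%E ;
  ds_normoo : forall f : Lspaceoo mu,
    (class_norm +oo (ds_op (Lspaceoo_sum f)) <= class_norm +oo f)%E }.

Lemma dunford_schwartz_ext (S S' : dunford_schwartz) :
  (forall f, S f = S' f) -> S = S'.
Proof.
case: S S' => [[S mS] S1 Soo] [[S' mS'] S'1 S'oo] /= /funext SS'.
move: SS' mS' S'1 S'oo => <- mS' S'1 S'oo; have mSE : mS = mS'.
  case: mS mS' {S1 Soo S'1 S'oo} => [[[a0 aD]] [b]] [[[a0' aD']] [b']].
  have -> : a0 = a0' by exact: Prop_irrelevance.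
  have -> : aD = aD' by exact: Prop_irrelevance.
  by have -> : b = b' by exact: Prop_irrelevance.
move: S'1 S'oo; rewrite -mSE => S'1 S'oo.
by congr DunfordSchwartz; exact: Prop_irrelevance.
Qed.

Lemma ds_restrict_oo_subproof (S : dunford_schwartz) (f : Lspaceoo mu) :
  (S (Lspaceoo_sum f) : L0) \in Lspace_pred mu +oo%E.
Proof.
apply/mem_set; apply: le_lt_trans (ds_normoo S f) _.
exact: Lebesgue_finite.
Qed.

Definition ds_restrict_oo (S : dunford_schwartz) (f : Lspaceoo mu) :
    Lspaceoo mu :=
  Lspace_Sub (leey 1%E) (ds_restrict_oo_subproof S f).

Definition duality_pairing (f : Lspaceoo mu) (g : Lspace1 mu) : R :=
  \int[mu]_x ((f : T -> R) x * (g : T -> R) x).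

(* The space L^oo with the topology sigma(L^oo, L^1), that is, the initial
   topology for all the maps [duality_pairing ^~ g]. *)
Definition Lspaceoo_weak : Type :=
  initial_topology (duality_pairing : Lspaceoo mu -> {ptws Lspace1 mu -> R}).
HB.instance Definition _ := Topological.on Lspaceoo_weak.

End DunfordSchwartz.

(* Main.v *)
Require Import Defs.
From HB Require Import structures.
From mathcomp Require Import all_boot all_order all_algebra.
From mathcomp Require Import all_classical all_reals all_analysis.
From mathcomp Require Import ring lra.
From mathcomp Require Import ess_sup_inf measurable_realfun.

Set Implicit Arguments.
Unset Strict Implicit.
Unset Printing Implicit Defensive.

Import Order.TTheory GRing.Theory Num.Theory.
Import numFieldNormedType.Exports.

Local Open Scope classical_set_scope.
Local Open Scope ring_scope.

(* On L^1 /\ L^oo the operator T is bounded for both norms, so by the Riesz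
   representation of (L^1)^* (where the direct sum property is used, to glue
   Radon-Nikodym densities over the sets of finite measure) every g in
   L^1 /\ L^oo has some h in L^oo with <h, u> = <g, T u> for all u in L^1; the
   bound |<h, u>| <= ||g||_1 ||u||_oo puts h in L^1 with ||h||_1 <= ||g||_1.
   By density and completeness of L^1 this gives a contraction T' of L^1 with
   <T u, g> = <u, T' g> for u in L^1 /\ L^oo and g in L^1.  The operator S is T
   on L^1 and the Banach adjoint of T' on L^oo; the two agree on
   L^1 /\ L^oo, and an adjoint is weakly continuous.  For uniqueness, every f
   in L^oo is the weak limit of the truncations f 1_E, with E of finite
   measure, which lie in L^1. *)

(** * Semifinite measures *)

(** Why an adjoint: L^1 /\ L^oo is in general not norm dense in L^oo, so [S] cannot be obtained
    there from T by norm continuity. It has to come from a predual T' acting on L^1, whereas the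
    Banach adjoint of T only acts on L^oo; hence the detour through L^1 /\ L^oo. The obstacle is
    that [mu] need not be sigma-finite. Radon-Nikodym is available only on each set of finite
    measure, and the densities, each defined up to its own null set, must be patched over an
    uncountable family. Pointwise gluing fails; instead the superlevel sets at rational thresholds
    are glued, as suprema in the complete measure algebra, and the function is rebuilt from
    countably many of them. Semifiniteness has a separate role: it allows both norms to be tested on
    sets of finite measure, and so to be read off from the pairing. *)

Lemma exists_natSinv_le (R : realType) (e : R) :
  0 < e -> exists n : nat, n.+1%:R^-1 <= e.
Proof.
move=> e0; have [n _ /(_ n (leqnn n)) /ltW ne] := near_infty_natSinv_lt (PosNum e0).
by exists n.
Qed.

Section semifinite.
Context d (T : measurableType d) (R : realType).
Variable mu : {measure set T -> \bar R}.

Lemma measureU_lty (A B : set T) : measurable A -> measurable B ->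
  (mu A < +oo)%E -> (mu B < +oo)%E -> (mu (A `|` B) < +oo)%E.
Proof.
move=> mA mB Ay By; apply: le_lt_trans (measureU2 mu mA mB) _.
exact: lte_add_pinfty.
Qed.

Definition level (f : T -> R) (n : nat) : set T :=
  [set x | n.+1%:R^-1 <= `|f x|].

Lemma measurable_level (f : T -> R) n :
  measurable_fun [set: T] f -> measurable (level f n).
Proof.
move=> mf; rewrite -[level f n]setTI.
by apply: measurable_fun_le => //; exact: measurableT_comp.
Qed.

Lemma nondecreasing_level (f : T -> R) : nondecreasing_seq (level f).
Proof.
move=> m n mn; rewrite subsetEset => x; apply: le_trans.
by rewrite lef_pV2 ?posrE// ler_nat.
Qed.

Lemma bigcup_level (f : T -> R) : \bigcup_n level f n = [set x | f x != 0].
Proof.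
apply/seteqP; split=> [x [n _]|x /= fx0].
  by apply: contraTneq => ->; rewrite normr0 -ltNge.
have fx : 0 < `|f x| by rewrite normr_gt0.
by have [n nfx] := exists_natSinv_le fx; exists n.
Qed.

Lemma level_cvg_integral (f : T -> R) : measurable_fun [set: T] f ->
  (\int[mu]_(x in level f n) `|f x|%:E)%E @[n --> \oo] -->
  (\int[mu]_x `|f x|%:E)%E.
Proof.
move=> mf.
have -> : (\int[mu]_x `|f x|%:E = \int[mu]_(x in \bigcup_n level f n) `|f x|%:E)%E.
  rewrite [RHS]integral_mkcond; apply: eq_integral => x _.
  rewrite patchE bigcup_level; case: ifPn => //.
  by rewrite notin_setE /= => /negP; rewrite negbK => /eqP ->; rewrite normr0.
apply: ge0_nondecreasing_set_cvg_integral => //.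
- exact: nondecreasing_level.
- by move=> n; exact: measurable_level.
- move=> n; apply: measurable_funTS; apply/measurable_EFinP.
  exact: measurableT_comp.
Qed.

(** Markov's inequality. Allowing any [E] inside the level set makes it usable before the level set
    itself is known to have finite measure. *)
Lemma level_measure_le (f : T -> R) n (E : set T) : measurable_fun [set: T] f ->
  measurable E -> E `<=` level f n ->
  (mu E <= n.+1%:R%:E * \int[mu]_(x in E) `|f x|%:E)%E.
Proof.
move=> mf mE Ef.
have : (n.+1%:R^-1%:E * mu E <= \int[mu]_(x in E) `|f x|%:E)%E.
  rewrite -integral_cst//; apply: ge0_le_integral => //.
  - by move=> x _; rewrite /= lee_fin invr_ge0.
  - by apply: measurable_funTS; apply/measurable_EFinP; exact: measurableT_comp.
by rewrite lee_pdivrMl.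
Qed.

Lemma integrable_level (f : T -> R) n : mu.-integrable [set: T] (EFin \o f) ->
  (mu (level f n) < +oo)%E.
Proof.
move=> /integrableP[/measurable_EFinP mf fy].
have mA := measurable_level n mf.
apply: le_lt_trans (level_measure_le mf mA (@subset_refl _ _)) _.
apply: lte_mul_pinfty => //; apply: le_lt_trans fy.
apply: ge0_subset_integral => //.
by apply/measurable_EFinP; exact: measurableT_comp.
Qed.

(** By monotone convergence over the level sets, which have finite measure, the complement of a late
    one carries little mass. *)
Lemma tail_integrable (f : T -> R) (e : R) :
  mu.-integrable [set: T] (EFin \o f) -> 0 < e ->
  exists E, [/\ measurable E, (mu E < +oo)%E &
    (\int[mu]_(x in ~` E) `|f x|%:E < e%:E)%E].
Proof.
move=> fi e0; have /integrableP[/measurable_EFinP mf fy] := fi.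
have fcv := level_cvg_integral mf.
have ffin : (\int[mu]_x `|f x|%:E)%E \is a fin_num.
  by rewrite ge0_fin_numE// integral_ge0.
have mf' D : measurable_fun D (fun x => `|f x|%:E).
  by apply: measurable_funTS; apply/measurable_EFinP; exact: measurableT_comp.
have : \forall n \near \oo,
   (\int[mu]_x `|f x|%:E - e%:E < \int[mu]_(x in level f n) `|f x|%:E)%E.
  apply: (fcv (fun z => _ < z)%E).
  apply: open_nbhs_nbhs; split; first exact: open_ereal_gt_ereal.
  have : (\int[mu]_x `|f x|%:E - e%:E < \int[mu]_x `|f x|%:E)%E.
    by rewrite gte_subl// lte_fin.
  exact.
case=> n _ /(_ n (leqnn n)) /= h.
exists (level f n); split; [exact: measurable_level|exact: integrable_level|].
have mA := measurable_level n mf.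
move: h; rewrite -{1}(setUv (level f n)) ge0_integral_setU//; last 2 first.
- exact: measurableC.
- exact/disj_setPCl.
have afin : (\int[mu]_(x in level f n) `|f x|%:E)%E \is a fin_num.
  rewrite ge0_fin_numE ?integral_ge0//; apply: le_lt_trans fy.
  exact: ge0_subset_integral.
by rewrite EFinN lteBlDr// lteD2lE.
Qed.

Hypothesis sf : semifinite_measure mu.

(** Exhaustion: a countable union [V] of finite-measure subsets of [A] attains the supremum [s] of
    their measures. The rest of [A] is then null, since by semifiniteness it would otherwise contain
    a piece of finite non-zero measure, and adding it to [V] would exceed [s]. *)
Lemma semifinite_lty (A : set T) (C : R) : measurable A ->
  (forall E, measurable E -> E `<=` A -> (mu E < +oo)%E -> (mu E <= C%:E)%E) ->
  (mu A < +oo)%E.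
Proof.
move=> mA hC.
pose F := [set E | [/\ measurable E, E `<=` A & (mu E < +oo)%E]].
have F0 : F set0 by split => //; rewrite measure0.
pose s := ereal_sup [set mu E | E in F].
have sC : (s <= C%:E)%E by apply: ge_ereal_sup => _ [E [mE EA Ey] <-]; exact: hC.
have s0 : (0 <= s)%E by apply: ereal_sup_ubound; exists set0; rewrite ?measure0.
have sfin : s \is a fin_num by rewrite ge0_fin_numE// (le_lt_trans sC)// ltry.
have ex n : exists E, F E /\ (s - n.+1%:R^-1%:E < mu E)%E.
  have [|_ [E FE <-] h] := @ub_ereal_sup_adherent _ [set mu E | E in F] n.+1%:R^-1
    _ sfin.
    by rewrite invr_gt0 ltr0Sn.
  by exists E; split.
have [E /all_and2[FE sE]] := choice ex.
pose U n := \big[setU/set0]_(i < n.+1) E i.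
have FU n : F (U n).
  rewrite /U; elim: n.+1 => [|m [mU UA Uy]]; first by rewrite big_ord0.
  have [mE EA Ey] := FE m.
  rewrite big_ord_recr /=; split; [exact: measurableU|by rewrite subUset|].
  exact: measureU_lty.
have mU n : measurable (U n) by have [] := FU n.
pose V := \bigcup_n U n.
have mV : measurable V by exact: bigcup_measurable.
have VA : V `<=` A by move=> x [n _ Unx]; have [_ + _] := FU n; apply.
have Vs : mu V = s.
  have cv : mu (U n) @[n --> \oo] --> mu V.
    apply: nondecreasing_cvg_mu => //.
    by move=> m n mn; rewrite subsetEset; exact: subset_bigsetU.
  apply/eqP; rewrite eq_le; apply/andP; split.
    apply: cvge_to_le cv _.
    by apply: nearW => n; apply: ereal_sup_ubound; exists (U n).
  rewrite leNgt; apply/negP => Vs.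
  have Vfin : mu V \is a fin_num by rewrite ge0_fin_numE// (lt_trans Vs)// ltey_eq
    sfin.
  have := Vs; rewrite -(fineK sfin) -(fineK Vfin) lte_fin -subr_gt0.
  set e := _ - _ => e0.
  have [n ne] := exists_natSinv_le e0.
  have := sE n; rewrite ltNge => /negP; apply.
  apply: (@le_trans _ _ (mu V)).
    apply: le_measure; rewrite ?inE//; first by have [] := FE n.
    by move=> x Ex; exists n => //; rewrite /U -bigcup_mkord; exists n => /=.
  by rewrite -(fineK sfin) -(fineK Vfin) -EFinB lee_fin lerBrDr -lerBrDl.
have [D0|D0] := eqVneq (mu (A `\` V)) 0%E.
  rewrite (_ : mu A = s) ?ltey_eq ?sfin//.
  rewrite -(setDUK VA) setUC measureU//; last 2 first.
  - exact: measurableD.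
  - by rewrite setDE -setIA setICl setI0.
  by rewrite [X in (X + _)%E]D0 add0e.
have [B [mB BA B0 By]] := sf (measurableD mA mV) D0.
have : (mu (V `|` B) <= s)%E.
  apply: ereal_sup_ubound; exists (V `|` B) => //; split.
  - exact: measurableU.
  - by rewrite subUset; split => // x /BA[].
  - by apply: measureU_lty => //; rewrite [ltLHS]Vs ltey_eq sfin.
rewrite measureU//; last first.
  by apply/seteqP; split => // x [Vx /BA[]].
by rewrite [X in (X + _)%E]Vs leNgt lteDl// lt0e B0 measure_ge0.
Qed.

(** Integrability of [f] is a consequence here: Markov's inequality and [semifinite_lty] force every
    level set to have finite measure, and monotone convergence concludes. *)
Lemma semifinite_integral_le (f : T -> R) (C : R) : measurable_fun [set: T] f ->
  (forall E, measurable E -> (mu E < +oo)%E ->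
    (\int[mu]_(x in E) `|f x|%:E <= C%:E)%E) ->
  (\int[mu]_x `|f x|%:E <= C%:E)%E.
Proof.
move=> mf fC; have cv := level_cvg_integral mf.
apply: cvge_to_le cv _.
apply: nearW => n; apply: (fC); first exact: measurable_level.
apply: (@semifinite_lty _ (n.+1%:R * C)) => [|E mE Ef Ey].
  exact: measurable_level.
apply: (le_trans (level_measure_le mf mE Ef)).
by rewrite EFinM lee_pmul2l ?lte_fin// fC.
Qed.

(** If [|f|] exceeded [C] by some 1/(n+1) on a non-null set, a subset of finite non-zero measure
    would violate the integral bound. *)
Lemma semifinite_ae_le (f : T -> R) (C : R) : measurable_fun [set: T] f ->
  (forall E, measurable E -> (mu E < +oo)%E ->
    (\int[mu]_(x in E) `|f x|%:E <= C%:E * mu E)%E) ->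
  \forall x \ae mu, `|f x| <= C.
Proof.
move=> mf fC.
have : \forall x \ae mu, forall n, `|f x| < C + n.+1%:R^-1.
  apply: ae_foralln => n.
  pose A := [set x | C + n.+1%:R^-1 <= `|f x|].
  have mA : measurable A.
    rewrite -[A]setTI.
    by apply: measurable_fun_le => //; exact: measurableT_comp.
  have A0 : mu A = 0%E.
    apply: contrapT => /eqP /(sf mA)[B [mB BA B0 By]].
    have : ((C + n.+1%:R^-1)%:E * mu B <= C%:E * mu B)%E.
      apply: le_trans (fC _ mB By); rewrite -integral_cst//.
      (* The sign of [C] is not given; for a negative constant the left side is at most 0. *)
      have [r0|r0] := leP 0 (C + n.+1%:R^-1).
        apply: ge0_le_integral => //.
        by apply: measurable_funTS; apply/measurable_EFinP; exact: measurableT_comp.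
      apply: (@le_trans _ _ 0%E); last exact: integral_ge0.
      by rewrite integral_cst// mule_le0_ge0// lee_fin ltW.
    have Bf : mu B \is a fin_num by rewrite ge0_fin_numE.
    rewrite -(fineK Bf) -!EFinM lee_fin ler_pM2r;
      first by rewrite gerDl leNgt invr_gt0 ltr0Sn.
    by rewrite fine_gt0// By andbT lt0e B0 measure_ge0.
  exists A; split => // x /= /negP; rewrite -leNgt; exact.
apply: filterS => x h; apply/ler_addgt0Pr => e e0.
have [n ne] := exists_natSinv_le e0.
by apply: (le_trans (ltW (h n))); rewrite lerD2l.
Qed.

End semifinite.

(** * Gluing and densities of set functions *)

Section direct_sum.
Context d (T : measurableType d) (R : realType).
Variable mu : {measure set T -> \bar R}.
Hypothesis dsp : direct_sum_property mu.

(** [V] is the essential union of a possibly uncountable family: a representative of its supremum in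
    the measure algebra. Order completeness of that algebra enters only here. *)
Lemma ess_bigcup (F : set (set T)) : (forall A, F A -> measurable A) ->
  exists V, [/\ measurable V, forall A, F A -> mu (A `\` V) = 0%E &
    forall W, measurable W -> (forall A, F A -> mu (A `\` W) = 0%E) ->
      mu (V `\` W) = 0%E].
Proof.
move=> mF; have [_ _ sups] := dsp.
pose cl (A : measurable_set T) : measure_algebra mu := \pi_(measure_algebra mu)%qT A.
have [b [ubb lbb]] := sups [set a | exists2 A, F (val A) & a = cl A].
pose V := repr b; have Vb : b = cl V by rewrite /cl reprK.
exists (val V); split; first exact: measurable_setP.
  move=> A FA; have : (cl (exist _ A (mem_set (mF _ FA))) <= b)%O.
    by apply: ubb; exists (exist _ A (mem_set (mF _ FA))).
  by rewrite Vb /cl measure_algebra_leE => /eqP.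
move=> W mW FW; pose W' : measurable_set T := exist _ W (mem_set mW).
have : (b <= cl W')%O.
  by apply: lbb => _ [A FA ->]; rewrite /cl measure_algebra_leE; apply/eqP/FW.
by rewrite Vb /cl measure_algebra_leE => /eqP.
Qed.

(** For each rational [q], [V q] is the essential union of the sets where some local function
    exceeds [q], and the glued function is the supremum of the [q] with [x] in [V q]. On a fixed [E]
    only countably many null sets, one per rational, have to be discarded. *)
Lemma glue_functions (h : set T -> T -> R) :
  (forall E, measurable_fun [set: T] (h E)) ->
  (forall E E', measurable E -> measurable E' ->
    (mu E < +oo)%E -> (mu E' < +oo)%E ->
    \forall x \ae mu, E x -> E' x -> h E x = h E' x) ->
  exists2 g, measurable_fun [set: T] g & forall E, measurable E -> (mu E < +oo)%E ->
    \forall x \ae mu, E x -> g x = h E x.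
Proof.
move=> mh hE.
have mlt (q : rat) E : measurable [set x | ratr q < h E x].
  by have := mh E measurableT _ (measurable_itv `]ratr q, +oo[);
    rewrite setTI preimage_itvoy.
pose F q := [set A | exists E, [/\ measurable E, (mu E < +oo)%E &
   A = E `&` [set x | ratr q < h E x]]].
have /choice[V /all_and3[mV FV VF]] (q : rat) := @ess_bigcup (F q)
  ltac:(by move=> _ [E [mE _ ->]]; exact: measurableI).
(* At [x] this sequence lists the rationals [q] with [x] in [V q], filled up with [-oo], so that its
   supremum is a measurable countable supremum. *)
pose s (n : nat) (x : T) : \bar R := if unpickle n is Some q then
  (if x \in V q then (ratr q)%:E else -oo)%E else -oo%E.
have ms n : measurable_fun [set: T] (s n).
  rewrite /s; case: (unpickle n) => [q|]; last exact: measurable_cst.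
  apply: measurable_fun_ifT => //.
  by apply: (measurable_fun_bool true); rewrite setTI preimage_mem_true.
pose g0 x := esups (s ^~ x) 0%N.
have mg0 : measurable_fun [set: T] g0 by exact: measurable_fun_esups.
(* [fine] replaces infinite values by 0; on each set of finite measure [g0] turns out to be finite
   almost everywhere. *)
exists (fine \o g0); first exact: measurableT_comp.
move=> E mE Ey.
have VE q : \forall x \ae mu, E x -> (V q x <-> ratr q < h E x).
  have h1 : \forall x \ae mu, E x -> ratr q < h E x -> V q x.
    exists ((E `&` [set x | ratr q < h E x]) `\` V q); split.
    - by apply: measurableD => //; exact: measurableI.
    - by apply: FV; exists E.
    - by move=> x /= /not_implyP[Ex /not_implyP[]].
  have h2 : \forall x \ae mu, E x -> V q x -> ratr q < h E x.
    (* [W] is the largest set whose trace on [E] is the superlevel set of [h E]. Consistency of the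
       family makes it an essential upper bound of [F q], so minimality of [V q] applies. *)
    pose W := ~` E `|` [set x | ratr q < h E x].
    have mW : measurable W by apply: measurableU => //; exact: measurableC.
    exists (V q `\` W); split; first exact: measurableD.
      apply: VF => // _ [E' [mE' E'y ->]].
      apply/negligibleP; first by apply: measurableD => //; exact: measurableI.
      apply: negligibleS (hE _ _ mE mE' Ey E'y) => x /= [[E'x qx] nWx] hx.
      apply: nWx; have [Ex|nEx] := pselect (E x); last by left.
      by right; rewrite /= hx.
    move=> x /= /not_implyP[Ex /not_implyP[Vx nx]]; split => // -[|] //.
  by apply: filterS2 h1 h2 => x h1 h2 Ex; split; [exact: h2|exact: h1].
have : \forall x \ae mu, forall n, if unpickle n is Some q then
    E x -> (V q x <-> ratr q < h E x) else True.
  apply: ae_foralln => n; case: unpickle => [q|]; [exact: VE|exact: aeW].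
apply: filterS => x Vx Ex.
suff g0h : g0 x = (h E x)%:E by rewrite /= g0h.
apply/eqP; rewrite eq_le; apply/andP; split.
  apply: ge_ereal_sup => _ [n _ <-]; rewrite /s.
  have := Vx n; case: unpickle => [q|_]; last exact: leNye.
  move=> /(_ Ex)[Vh _]; case: ifPn => [/set_mem/Vh /ltW|_]; last exact: leNye.
  by rewrite lee_fin.
apply/lee_addgt0Pr => e e0; rewrite -leeBlDr//.
have [|q] := @rat_in_itvoo R (h E x - e) (h E x); first by rewrite gtrBl.
rewrite in_itv /= => /andP[eq qh].
apply: (@le_trans _ _ (ratr q)%:E); first by rewrite -EFinB lee_fin ltW.
apply: ereal_sup_ubound; exists (pickle q) => //.
rewrite /s pickleK ifT//; apply/mem_set.
by have := Vx (pickle q); rewrite pickleK => /(_ Ex)[_]; exact.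
Qed.

End direct_sum.

(** * Set functions dominated by the measure, and their densities *)

Section set_function_density.
Context d (T : measurableType d) (R : realType).
Variables (mu : {measure set T -> \bar R}) (phi : set T -> R) (C : R).
Hypothesis phiU : forall A B, measurable A -> measurable B ->
  (mu A < +oo)%E -> (mu B < +oo)%E -> A `&` B = set0 ->
  phi (A `|` B) = phi A + phi B.
Hypothesis phi_le : forall A, measurable A -> (mu A < +oo)%E ->
  (`|phi A|%:E <= C%:E * mu A)%E.

Section restriction.
Variables (E : set T) (mE : measurable E) (Ey : (mu E < +oo)%E).

(** Nothing is known about [phi] on sets of infinite measure; the intersection with [E] gives a
    charge on all measurable sets. *)
Definition restricted_set_function (A : set T) : \bar R := (phi (A `&` E))%:E.
Local Notation nu := restricted_set_function.

Let EyI A : measurable A -> (mu (A `&` E) < +oo)%E.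
Proof.
move=> mA; apply: le_lt_trans Ey; apply: le_measure; rewrite ?inE//.
exact: measurableI.
Qed.

Let phi0 : phi set0 = 0.
Proof.
by have := phi_le (measurable0);
  rewrite measure0 mule0 lee_fin normr_le0 => /(_ (ltry 0)) /eqP.
Qed.

Let nu0 : nu set0 = 0%E.
Proof. by rewrite /nu set0I phi0. Qed.

Let nu_fin A : measurable A -> nu A \is a fin_num.
Proof. by []. Qed.

(** Finite additivity becomes countable additivity because [|phi|] is at most [C * mu], and the
    tails of the union, cut down to [E], decrease to the empty set with finite measure. *)
Let nu_sigma_additive : semi_sigma_additive nu.
Proof.
move=> F mF tF mUF.
pose G n := \big[setU/set0]_(i < n) F i.
have mG n : measurable (G n) by exact: bigsetU_measurable.
have nuG n : (\sum_(0 <= i < n) nu (F i))%E = nu (G n).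
  elim: n => [|n IH]; first by rewrite big_geq// /G big_ord0 nu0.
  rewrite big_nat_recr//= IH /G big_ord_recr /= -/(G n) /nu -EFinD; congr EFin.
  rewrite setIUl phiU//;
    [exact: measurableI|exact: measurableI|exact: EyI|exact: EyI|].
  apply/seteqP; split => // x [[Gx _] [Fx _]].
  move: Gx; rewrite /G -bigcup_mkord => -[i /= iltn Fix].
  by have := tF i n I I (ex_intro _ x (conj Fix Fx)) => iE; rewrite iE ltnn in iltn.
under eq_fun do rewrite nuG.
set U := \bigcup_n F n.
have GU n : G n `<=` U by rewrite /G -bigcup_mkord => x [i _ Fix]; exists i.
have GD n : nu U = (nu (G n) + nu (U `\` G n))%E.
  rewrite /nu -EFinD -phiU; [|exact: measurableI| |exact: EyI| |].
  - by rewrite -setIUl setDUK.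
  - by apply: measurableI => //; exact: measurableD.
  - by apply: EyI; exact: measurableD.
  - by apply/seteqP; split => // x [[Gx _] [[_ nGx] _]].
have cv0 : mu ((U `\` G n) `&` E) @[n --> \oo] --> 0%E.
  rewrite [X in _ --> X](_ : _ = mu (\bigcap_n ((U `\` G n) `&` E))); last first.
    rewrite (_ : \bigcap_n _ = set0) ?measure0//.
    apply/seteqP; split => // x h.
    have [[[n _ Fnx] _] _] := h 0%N I.
    have [[_ nG] _] := h n.+1 I; apply: nG.
    by rewrite /G -bigcup_mkord; exists n => /=.
  apply: nonincreasing_cvg_mu.
  - by apply: EyI; exact: measurableD.
  - by move=> n; apply: measurableI => //; exact: measurableD.
  - apply: bigcap_measurable => [|n _]; first by exists 0%N.
    by apply: measurableI => //; exact: measurableD.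
  - move=> m n mn; rewrite subsetEset => x [[Ux nGx] Ex]; split => //;
    split => // Gx.
    by apply: nGx; exact: (subset_bigsetU mn).
have nuD n : (nu (G n) - nu U)%E = (- nu (U `\` G n))%E.
  by rewrite (GD n) fin_num_oppeD// addeA subee// add0e.
apply/sube_cvg0 => //; apply/cvg_abse0P.
apply: (@squeeze_cvge _ _ _ _ (cst 0%E) _ (fun n => C%:E * mu ((U `\` G n) `&`
  E)))%E.
- apply: nearW => n; rewrite abse_ge0.
  suff : (`|nu (G n) - nu U| <= C%:E * mu ((U `\` G n) `&` E))%E by [].
  rewrite nuD abseN.
  by apply: phi_le; [apply: measurableI => //; exact: measurableD|apply: EyI;
    exact: measurableD].
- exact: cvg_cst.
- by rewrite -[X in _ --> X](mule0 C%:E); exact: cvgeZl.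
Qed.

HB.instance Definition _ := isCharge.Build _ _ _ nu nu0 nu_fin nu_sigma_additive.

(** Radon-Nikodym is applied against the restriction of [mu] to [E], a finite measure; integrals
    over subsets of [E] are the same for both measures. *)
Lemma density_on_finite : exists2 h, measurable_fun [set: T] h &
  forall A, measurable A -> A `<=` E ->
    mu.-integrable A (EFin \o h) /\ (\int[mu]_(x in A) (h x)%:E = (phi A)%:E)%E.
Proof.
pose muE : {finite_measure set T -> \bar R} := mfrestr mE Ey.
have nudom : nu `<< muE.
  apply/null_content_dominatesP => A mA.
  rewrite /muE /= /mfrestr /mrestr => A0.
  have := phi_le (measurableI _ _ mA mE) (EyI mA).
  by rewrite A0 mule0 lee_fin normr_le0 /nu => /eqP ->.
pose f := Radon_Nikodym nu muE.
have fint := Radon_Nikodym_integrable nudom.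
have fE A : measurable A -> A `<=` E -> (\int[mu]_(x in A) f x = nu A)%E.
  move=> mA AE; rewrite (Radon_Nikodym_integral nudom)//.
  apply: eq_measure_integral => B mB BA.
  by rewrite /muE /= /mfrestr /mrestr setIidl//; exact: subset_trans AE.
have ff x : f x \is a fin_num by exact: Radon_Nikodym_fin_num.
have mf : measurable_fun [set: T] f by exact: measurable_int fint.
have fK : EFin \o (fine \o f) = f by apply/funext => x /=; rewrite fineK.
exists (fine \o f); first exact: measurableT_comp.
move=> A mA AE; rewrite fK; split; last first.
  rewrite (_ : (fun x => _) = f); last by rewrite -[RHS]fK.
  by rewrite fE// /nu setIidl.
apply/integrableP; split; first exact: measurable_funTS.
have /integrableP[_ ] := integrableS measurableT mA (@subsetT _ _) fint.
rewrite (_ : \int[muE]_(x in A) `|f x| = \int[mu]_(x in A) `|f x|)%E//.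
apply: eq_measure_integral => B mB BA.
by rewrite /muE /= /mfrestr /mrestr setIidl//; exact: subset_trans AE.
Qed.

End restriction.

Hypothesis dsp : direct_sum_property mu.

(** Two local densities have the same integral over every measurable subset of an overlap, hence
    agree there almost everywhere and can be glued. *)
Lemma set_function_density : exists h : T -> R,
  [/\ measurable_fun [set: T] h, \forall x \ae mu, `|h x| <= C &
    forall A, measurable A -> (mu A < +oo)%E ->
      mu.-integrable A (EFin \o h) /\ (\int[mu]_(x in A) (h x)%:E = (phi A)%:E)%E].
Proof.
have ex (E : set T) : exists h : T -> R, measurable_fun [set: T] h /\
    (measurable E -> (mu E < +oo)%E -> forall A, measurable A -> A `<=` E ->
      mu.-integrable A (EFin \o h) /\ (\int[mu]_(x in A) (h x)%:E = (phi A)%:E)%E).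
  have [[mE Ey]|nE] := pselect (measurable E /\ (mu E < +oo)%E).
    by have [h mh hA] := density_on_finite mE Ey; exists h.
  by exists (cst 0); split => // mE Ey; case: nE.
have [h /all_and2[mh hP]] := choice ex.
have [|g mg gh] := glue_functions dsp mh.
  move=> E E' mE mE' Ey E'y.
  have mI : measurable (E `&` E') by exact: measurableI.
  have [ih _] := hP _ mE Ey _ mI (@subIsetl _ _ _).
  have := @integral_ae_eq _ _ _ mu _ mI (EFin \o h E') _ ih.
  case; first by apply: measurable_funTS; exact/measurable_EFinP.
    move=> A AI mA.
    have [_ ->] := hP _ mE Ey _ mA (subset_trans AI (@subIsetl _ _ _)).
    by have [_ ->] := hP _ mE' E'y _ mA (subset_trans AI (@subIsetr _ _ _)).
  move=> N [mN N0 hN]; exists N; split => //.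
  apply: subset_trans hN => x /= /not_implyP[Ex /not_implyP[E'x hx]].
  by move=> /(_ (conj Ex E'x)) [].
have gP A : measurable A -> (mu A < +oo)%E ->
    mu.-integrable A (EFin \o g) /\ (\int[mu]_(x in A) (g x)%:E = (phi A)%:E)%E.
  move=> mA Ay; have [ih hA] := hP _ mA Ay _ mA (@subset_refl _ _).
  have ghA : ae_eq mu A (EFin \o g) (EFin \o h A).
    by apply: filterS (gh _ mA Ay) => x ghx Ax; rewrite /= ghx.
  have mgA : measurable_fun A (EFin \o g).
    by apply: measurable_funTS; exact/measurable_EFinP.
  have mhA : measurable_fun A (EFin \o h A).
    by apply: measurable_funTS; exact/measurable_EFinP.
  split; last by rewrite -hA; exact: ae_eq_integral.
  apply/integrableP; split => //.
  have /integrableP[_] := ih; congr (_ < _)%E.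
  apply: ge0_ae_eq_integral => //; try exact: measurableT_comp.
  by apply: filterS ghA => x /[apply] ->.
exists g; split => //; have [_ sf _] := dsp.
apply: semifinite_ae_le => // E mE Ey.
(* Cutting [E] by the sign of [g] turns the integral of [|g|] into [phi P - phi N], to which the
   bound on [phi] applies. *)
pose P := E `&` [set x | 0 <= g x]; pose N := E `\` [set x | 0 <= g x].
have mg0 : measurable [set x | 0 <= g x].
  by have := mg measurableT _ (measurable_itv `[0, +oo[);
    rewrite setTI preimage_itvcy.
have mP : measurable P by exact: measurableI.
have mN : measurable N by exact: measurableD.
have Py : (mu P < +oo)%E.
  by apply: le_lt_trans Ey; apply: le_measure; rewrite ?inE// => x [].
have Ny : (mu N < +oo)%E.
  by apply: le_lt_trans Ey; apply: le_measure; rewrite ?inE// => x [].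
have EPN : E = P `|` N by rewrite /P /N setUIDK.
have PN : P `&` N = set0 by apply/seteqP; split => // x [[_ ?] [_]].
have mgD D : measurable_fun D (fun x => `|g x|%:E).
  by apply: measurable_funTS; apply/measurable_EFinP; exact: measurableT_comp.
rewrite {1}EPN ge0_integral_setU//; last exact/disj_set2P.
rewrite EPN measureU// muleDr//; last by rewrite ge0_adde_def// inE.
apply: leeD.
  rewrite (_ : \int[mu]_(x in P) _ = (phi P)%:E)%E.
    by apply: le_trans (phi_le mP Py); rewrite lee_fin ler_norm.
  by rewrite -(gP _ mP Py).2; apply: eq_integral => x /set_mem[_ /= gx];
    rewrite ger0_norm.
rewrite (_ : \int[mu]_(x in N) _ = - (phi N)%:E)%E.
  by apply: le_trans (phi_le mN Ny); rewrite lee_fin -normrN ler_norm.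
rewrite -(gP _ mN Ny).2 -integralN/=; last exact/integrable_add_def/(gP _ mN Ny).1.
apply: eq_integral => x /set_mem[_ /= gx].
by rewrite ltr0_norm// ltNge; exact/negP.
Qed.

End set_function_density.

(** * Classes of functions *)

Section classes.
Context d (T : measurableType d) (R : realType).
Variable mu : {measure set T -> \bar R}.
Local Notation L0 := {mfun_ mu, T >-> measurableTypeR R}.
Local Notation rp := (@L0_repr d T R mu).
Local Notation L1 := (Lspace1 mu).
Local Notation Loo := (Lspaceoo mu).

Lemma measurable_repr (f : L0) : measurable_fun [set: T] (rp f).
Proof. exact: measurable_funPT. Qed.
Hint Resolve measurable_repr : core.

Lemma repr_inj (f g : L0) : (\forall x \ae mu, rp f x = rp g x) -> f = g.
Proof.
move=> fg; rewrite -[f]L0_reprK -[g]L0_reprK; apply/L0_class_eqP.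
by apply: filterS fg.
Qed.

Lemma reprD (f g : L0) : \forall x \ae mu, rp (f + g) x = rp f x + rp g x.
Proof. by apply: filterS (L0_repr_class mu (rp f + rp g)) => x /(_ I). Qed.

Lemma reprN (f : L0) : \forall x \ae mu, rp (- f) x = - rp f x.
Proof. by apply: filterS (L0_repr_class mu (- rp f)) => x /(_ I). Qed.

Lemma reprB (f g : L0) : \forall x \ae mu, rp (f - g) x = rp f x - rp g x.
Proof. by apply: filterS2 (reprD f (- g)) (reprN g) => x -> ->. Qed.

Lemma reprZ (a : R) (f : L0) : \forall x \ae mu, rp (a *: f) x = a * rp f x.
Proof. by apply: filterS (L0_repr_class mu (a *: rp f)) => x /(_ I). Qed.

Lemma repr0 : \forall x \ae mu, rp 0 x = 0.
Proof. by apply: filterS (L0_repr_class mu 0) => x /(_ I). Qed.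

Lemma exists_class (f : T -> R) : measurable_fun [set: T] f ->
  exists F : L0, \forall x \ae mu, rp F x = f x.
Proof.
move=> mf; exists (L0_class mu (mfun_Sub (mem_set mf))).
have := L0_repr_class mu (mfun_Sub (mem_set mf) : {mfun T >-> R}).
by apply: filterS => x /(_ I).
Qed.

Lemma class_norm1E (f : L0) : class_norm 1 f = (\int[mu]_x `|rp f x|%:E)%E.
Proof. by rewrite /class_norm Lnorm1. Qed.

Lemma class_norm_ge0 p (f : L0) : (0 <= class_norm p f)%E.
Proof. exact: Lnorm_ge0. Qed.

Lemma Lspace_pred1P (f : L0) :
  f \in Lspace_pred mu 1%E <-> mu.-integrable [set: T] (EFin \o rp f).
Proof.
rewrite -[f in f \in _]L0_reprK Lspace_predE; exact: Lfun1_integrable.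
Qed.

Lemma class_normoo_leP (f : L0) (C : R) : 0 <= C ->
  (class_norm +oo f <= C%:E)%E <-> \forall x \ae mu, `|rp f x| <= C.
Proof.
move=> C0; rewrite /class_norm unlock /Lnorm; case: ifPn => [_|mu0]; last first.
  split=> _; last by rewrite lee_fin.
  exists [set: T]; split => //.
  by apply/eqP; move: mu0; rewrite -leNgt measure_le0.
split => [/ess_supP|fC].
  by apply: filterS => x; rewrite /= lee_fin.
by apply/ess_supP; apply: filterS fC => x; rewrite /= lee_fin.
Qed.

Lemma Lspace_predooP (f : L0) : f \in Lspace_pred mu +oo%E <->
  exists2 C, 0 <= C & \forall x \ae mu, `|rp f x| <= C.
Proof.
split=> [/set_mem fy|[C C0 fC]].
  have f0 := class_norm_ge0 +oo%E f.
  have ff : class_norm +oo f \is a fin_num by rewrite ge0_fin_numE.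
  exists (fine (class_norm +oo f)); first exact: fine_ge0.
  by apply/class_normoo_leP; [exact: fine_ge0|rewrite fineK].
by apply/mem_set/(@le_lt_trans _ _ C%:E); [exact/class_normoo_leP|exact: ltry].
Qed.

Lemma Lspace1_integrable (f : L1) : mu.-integrable [set: T] (EFin \o rp f).
Proof. exact/Lspace_pred1P/mem_set/Lebesgue_finite. Qed.

Lemma Lspaceoo_in (f : Loo) : (f : L0) \in Lspace_pred mu +oo%E.
Proof. exact/mem_set/Lebesgue_finite. Qed.

Lemma Lspaceoo_bounded (f : Loo) :
  exists2 C, 0 <= C & \forall x \ae mu, `|rp f x| <= C.
Proof. exact/Lspace_predooP/Lspaceoo_in. Qed.

Lemma class_norm1_fin (f : L1) : class_norm 1 f \is a fin_num.
Proof. by rewrite ge0_fin_numE ?class_norm_ge0//; exact: Lebesgue_finite. Qed.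

Lemma class_normoo_fin (f : Loo) : class_norm +oo f \is a fin_num.
Proof. by rewrite ge0_fin_numE ?class_norm_ge0//; exact: Lebesgue_finite. Qed.

Lemma integrable_ae_eq (f g : T -> R) : measurable_fun [set: T] g ->
  (\forall x \ae mu, g x = f x) ->
  mu.-integrable [set: T] (EFin \o f) -> mu.-integrable [set: T] (EFin \o g).
Proof.
move=> mg gf /integrableP[mf fy]; apply/integrableP; split;
  first exact/measurable_EFinP.
rewrite (_ : \int[mu]_x _ = \int[mu]_x `|(EFin \o f) x|)%E//.
apply: ge0_ae_eq_integral => //; first by apply: measurableT_comp => //;
  exact/measurable_EFinP.
  exact: measurableT_comp.
by apply: filterS gf => x /= ->.
Qed.

Lemma Lspace_predZ p (a : R) (f : L0) : (1 <= p)%E ->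
  f \in Lspace_pred mu p -> a *: f \in Lspace_pred mu p.
Proof. by move=> p1 fp; exact: valP (a *: Lspace_Sub p1 fp). Qed.

Lemma Lspace_predD p (f g : L0) : (1 <= p)%E -> f \in Lspace_pred mu p ->
  g \in Lspace_pred mu p -> f + g \in Lspace_pred mu p.
Proof. by move=> p1 fp gp; exact: valP (Lspace_Sub p1 fp + Lspace_Sub p1 gp). Qed.

Lemma exists_Lspace1 (f : T -> R) : mu.-integrable [set: T] (EFin \o f) ->
  exists F : L1, \forall x \ae mu, rp F x = f x.
Proof.
move=> fi; have mf : measurable_fun [set: T] f.
  by apply/measurable_EFinP; exact: measurable_int fi.
have [F Ff] := exists_class mf.
have F1 : F \in Lspace_pred mu 1%E.
  by apply/Lspace_pred1P; exact: integrable_ae_eq fi.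
by exists (Lspace_Sub (lexx 1%E) F1).
Qed.

Lemma exists_Lspaceoo (f : T -> R) (C : R) : measurable_fun [set: T] f -> 0 <= C ->
  (\forall x \ae mu, `|f x| <= C) ->
  exists F : Loo, \forall x \ae mu, rp F x = f x.
Proof.
move=> mf C0 fC; have [F Ff] := exists_class mf.
have Foo : F \in Lspace_pred mu +oo%E.
  apply/Lspace_predooP; exists C => //.
  by apply: filterS2 fC Ff => x + ->.
by exists (Lspace_Sub (leey 1%E) Foo).
Qed.

Lemma class_norm1_ae (f : L0) (g : T -> R) : measurable_fun [set: T] g ->
  (\forall x \ae mu, rp f x = g x) -> class_norm 1 f = (\int[mu]_x `|g x|%:E)%E.
Proof.
move=> mg fg; rewrite class_norm1E; apply: ge0_ae_eq_integral => //.
- by apply/measurable_EFinP; exact: measurableT_comp.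
- by apply/measurable_EFinP; exact: measurableT_comp.
- by apply: filterS fg => x ->.
Qed.

Lemma class_norm1D (f g : L0) :
  (class_norm 1 (f + g)%R <= class_norm 1 f + class_norm 1 g)%E.
Proof.
have mn (h : T -> R) : measurable_fun [set: T] h ->
    measurable_fun [set: T] (fun x => `|h x|%:E).
  by move=> mh; apply/measurable_EFinP; exact: measurableT_comp.
rewrite (class_norm1_ae _ (reprD f g)); last exact: measurable_funD.
rewrite !class_norm1E -ge0_integralD//; [|exact: mn|exact: mn].
apply: ge0_le_integral => //.
- by apply: mn; exact: measurable_funD.
- by apply: emeasurable_funD; exact: mn.
- by move=> x _; rewrite -EFinD lee_fin ler_normD.
Qed.

Lemma class_norm1N (f : L0) : class_norm 1 (- f)%R = class_norm 1 f.
Proof.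
rewrite (class_norm1_ae _ (reprN f)); last exact: measurableT_comp.
by rewrite class_norm1E; under eq_integral do rewrite normrN.
Qed.

Lemma class_norm1_le0 (f : L0) : (class_norm 1 f <= 0)%E -> f = 0.
Proof.
move=> f0; have f0' : class_norm 1 f = 0%E.
  by apply/eqP; rewrite eq_le f0 class_norm_ge0.
apply: repr_inj; have fE : EFin \o rp f = \0%E %[ae mu].
  apply: (Lnorm_eq0_eq0 _ _ f0'); last by rewrite lte_fin.
  by apply/measurable_EFinP; exact: measurable_repr.
by apply: filterS2 fE repr0 => x /(_ I) [] /= -> ->.
Qed.

Lemma class_normoo_le0 (f : L0) : (class_norm +oo f <= 0)%E -> f = 0.
Proof.
move=> /class_normoo_leP f0; apply: repr_inj; apply: filterS2 repr0 (f0 _) => //.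
by move=> x -> ; rewrite normr_le0 => /eqP.
Qed.

Lemma Rintegral_ae_eq (f g : T -> R) : measurable_fun [set: T] f ->
  measurable_fun [set: T] g -> (\forall x \ae mu, f x = g x) ->
  \int[mu]_x f x = \int[mu]_x g x.
Proof.
move=> mf mg fg; congr fine; apply: ae_eq_integral => //.
- exact/measurable_EFinP.
- exact/measurable_EFinP.
- by apply: filterS fg => x ->.
Qed.

(* Convertible to [duality_pairing], but stated on classes so that an element of
   L^1 /\ L^oo can be put on either side. *)
Definition pairing (f g : L0) : R := \int[mu]_x (rp f x * rp g x).

Lemma pairingC (f g : L0) : pairing f g = pairing g f.
Proof. by congr fine; apply: eq_integral => x _; rewrite mulrC. Qed.

Lemma integrableM_ae (f g : T -> R) (C : R) : measurable_fun [set: T] f ->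
  (\forall x \ae mu, `|f x| <= C) -> 0 <= C -> mu.-integrable [set: T] (EFin \o g) ->
  mu.-integrable [set: T] (EFin \o (fun x => f x * g x)) /\
  (\int[mu]_x `|f x * g x|%:E <= C%:E * \int[mu]_x `|g x|%:E)%E.
Proof.
move=> mf fC C0 /integrableP[/measurable_EFinP mg gy].
have mfg : measurable_fun [set: T] (fun x => f x * g x) by exact: measurable_funM.
have le : (\int[mu]_x `|f x * g x|%:E <= C%:E * \int[mu]_x `|g x|%:E)%E.
  rewrite -ge0_integralZl//; last by apply/measurable_EFinP; exact: measurableT_comp.
  apply: ae_ge0_le_integral => //.
  - by apply/measurable_EFinP; exact: measurableT_comp.
  - by move=> x _; rewrite mule_ge0 ?lee_fin.
  - by apply: measurable_funeM; apply/measurable_EFinP; exact: measurableT_comp.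
  - apply: filterS fC => x fC _ /=.
    by rewrite -EFinM lee_fin normrM ler_wpM2r.
split => //; apply/integrableP; split; first exact/measurable_EFinP.
by apply: le_lt_trans le _; exact: lte_mul_pinfty.
Qed.

Lemma integrable_pairing (f g : L0) :
  f \in Lspace_pred mu +oo%E -> g \in Lspace_pred mu 1%E ->
  mu.-integrable [set: T] (EFin \o (fun x => rp f x * rp g x)).
Proof.
move=> /Lspace_predooP[C C0 fC] /Lspace_pred1P g1.
by have [] := integrableM_ae (measurable_repr f) fC C0 g1.
Qed.

Lemma pairing_le (f g : L0) (C : R) : 0 <= C ->
  (\forall x \ae mu, `|rp f x| <= C) -> g \in Lspace_pred mu 1%E ->
  (`|pairing f g|%:E <= C%:E * class_norm 1 g)%E.
Proof.
move=> C0 fC /Lspace_pred1P g1.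
have [fg1 fgC] := integrableM_ae (measurable_repr f) fC C0 g1.
rewrite class_norm1E; apply: le_trans fgC.
rewrite EFin_normr_Rintegral//; apply: le_abse_integral => //.
exact: measurable_int fg1.
Qed.

Lemma pairingDr (f g g' : L0) : f \in Lspace_pred mu +oo%E ->
  g \in Lspace_pred mu 1%E -> g' \in Lspace_pred mu 1%E ->
  pairing f (g + g') = pairing f g + pairing f g'.
Proof.
move=> foo g1 g'1; rewrite /pairing -RintegralD//; [|exact: integrable_pairing..].
apply: Rintegral_ae_eq; first exact: measurable_funM.
  by apply: measurable_funD; exact: measurable_funM.
by apply: filterS (reprD g g') => x ->; rewrite mulrDr.
Qed.

Lemma pairingDl (f f' g : L0) : f \in Lspace_pred mu +oo%E ->
  f' \in Lspace_pred mu +oo%E -> g \in Lspace_pred mu 1%E ->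
  pairing (f + f') g = pairing f g + pairing f' g.
Proof.
move=> foo f'oo g1; rewrite /pairing -RintegralD//; [|exact: integrable_pairing..].
apply: Rintegral_ae_eq; first exact: measurable_funM.
  by apply: measurable_funD; exact: measurable_funM.
by apply: filterS (reprD f f') => x ->; rewrite mulrDl.
Qed.

Lemma pairingZr (a : R) (f g : L0) : f \in Lspace_pred mu +oo%E ->
  g \in Lspace_pred mu 1%E -> pairing f (a *: g) = a * pairing f g.
Proof.
move=> foo g1; rewrite /pairing -RintegralZl//; last exact: integrable_pairing.
apply: Rintegral_ae_eq; first exact: measurable_funM.
  by apply: measurable_funM => //; exact: measurable_funM.
by apply: filterS (reprZ a g) => x ->; rewrite mulrCA.
Qed.

Lemma pairingZl (a : R) (f g : L0) : f \in Lspace_pred mu +oo%E ->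
  g \in Lspace_pred mu 1%E -> pairing (a *: f) g = a * pairing f g.
Proof.
move=> foo g1; rewrite /pairing -RintegralZl//; last exact: integrable_pairing.
apply: Rintegral_ae_eq; first exact: measurable_funM.
  by apply: measurable_funM => //; exact: measurable_funM.
by apply: filterS (reprZ a f) => x ->; rewrite mulrA.
Qed.

Lemma pairingBr (f g g' : L0) : f \in Lspace_pred mu +oo%E ->
  g \in Lspace_pred mu 1%E -> g' \in Lspace_pred mu 1%E ->
  pairing f (g - g') = pairing f g - pairing f g'.
Proof.
move=> foo g1 g'1; rewrite -scaleN1r pairingDr//; last exact: Lspace_predZ.
by rewrite pairingZr// mulN1r.
Qed.

Lemma pairingBl (f f' g : L0) : f \in Lspace_pred mu +oo%E ->
  f' \in Lspace_pred mu +oo%E -> g \in Lspace_pred mu 1%E ->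
  pairing (f - f') g = pairing f g - pairing f' g.
Proof.
move=> foo f'oo g1; rewrite -scaleN1r pairingDl//;
  last by apply: Lspace_predZ => //; exact: leey.
by rewrite pairingZl// mulN1r.
Qed.

(** Riesz-Fischer: the geometric bound makes [G], the sum of [|f 0|] and all [|f n.+1 - f n|],
    integrable. Where [G] is finite the sequence converges, and [G] dominates it. *)
Lemma Lspace1_complete (f : nat -> L0) :
  (forall n, f n \in Lspace_pred mu 1%E) ->
  (forall n, class_norm 1 (f n.+1 - f n)%R <= (2^-1 ^+ n)%:E)%E ->
  exists2 g, g \in Lspace_pred mu 1%E &
    class_norm 1 (f n - g)%R @[n --> \oo] --> 0%E.
Proof.
move=> f1 fn.
pose D n x := `|rp (f n.+1) x - rp (f n) x|.
have D0 n x : (0 <= (D n x)%:E)%E by rewrite lee_fin /D.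
have mD n : measurable_fun [set: T] (D n).
  by apply: measurableT_comp => //; exact: measurable_funB.
pose G x := (`|rp (f 0%N) x|%:E + \sum_(n <oo) (D n x)%:E)%E.
have f0i : (\int[mu]_x `|rp (f 0%N) x|%:E < +oo)%E.
  by have /Lspace_pred1P/integrableP[] := f1 0%N.
have mS : measurable_fun [set: T] (fun x => \sum_(n <oo) (D n x)%:E)%E.
  apply: (@ge0_emeasurable_sum _ _ _ _ (fun n x => (D n x)%:E) xpredT) => //.
  by move=> n _; exact/measurable_EFinP.
have S0 x : (0 <= \sum_(n <oo) (D n x)%:E)%E. by exact: nneseries_ge0.
have m0 : measurable_fun [set: T] (fun x => `|rp (f 0%N) x|%:E).
  by apply/measurable_EFinP; exact: measurableT_comp.
have G0 x : (0 <= G x)%E by rewrite /G adde_ge0.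
have iG : mu.-integrable [set: T] G.
  apply/integrableP; split; first exact: emeasurable_funD.
  under eq_integral do rewrite gee0_abs//.
  rewrite ge0_integralD// lte_add_pinfty// integral_nneseries; last 3 first.
  - exact: measurableT.
  - by move=> n; exact/measurable_EFinP.
  - by move=> n x _; exact: D0.
  apply: (@le_lt_trans _ _ (\sum_(n <oo) (2^-1 ^+ n)%:E)%E).
    apply: lee_nneseries => [n _ _|n _].
      by apply: integral_ge0 => x _; exact: D0.
    apply: le_trans (fn n).
    rewrite (class_norm1_ae _ (reprB _ _)); last exact: measurable_funB.
    by [].
  (* 2 is the sum of the geometric series of ratio 1/2. *)
  apply: (@le_lt_trans _ _ 2%:E); last exact: ltry.
  apply: lime_le; first exact: is_cvg_nneseries.
  apply: nearW => n; rewrite sumEFin lee_fin.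
  suff -> : \sum_(0 <= i < n) 2^-1 ^+ i = 2 - 2 * 2^-1 ^+ n :> R.
    by rewrite gerBl mulr_ge0// exprn_ge0.
  elim: n => [|n IH]; first by rewrite big_geq// expr0 mulr1 subrr.
  by rewrite big_nat_recr//= IH exprS mulrA divff// mul1r; lra.
(* The upper limit is measurable on the whole space, and equals the limit wherever that exists. *)
pose k x := fine (limn_esup (fun n => (rp (f n) x)%:E)).
have mk : measurable_fun [set: T] k.
  apply: measurableT_comp => //; apply: measurable_fun_limn_esup => n.
  exact/measurable_EFinP.
have fG n x : (`|rp (f n) x|%:E <= G x)%E.
  apply: (@le_trans _ _ (`|rp (f 0%N) x|%:E + \sum_(0 <= i < n) (D i x)%:E)%E).
    elim: n => [|n IH]; first by rewrite big_geq// adde0.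
    rewrite big_nat_recr//= addeA -[X in `|X|](subrK (rp (f n) x)) addrC.
    apply: (@le_trans _ _ (`|rp (f n) x|%:E + (D n x)%:E)%E).
      by rewrite -EFinD lee_fin ler_normD.
    exact: leeD2r.
  by rewrite leeD2l//; apply: nneseries_lim_ge.
have fk : \forall x \ae mu, (rp (f n) x)%:E @[n --> \oo] --> (k x)%:E.
  apply: filterS (integrable_ae measurableT iG) => x /(_ I) Gx.
  have Sx : (\sum_(n <oo) (D n x)%:E)%E \is a fin_num.
    rewrite ge0_fin_numE//; apply: (@le_lt_trans _ _ (G x));
      first by rewrite /G leeDr.
    by rewrite ltey_eq Gx.
  have cv : cvgn (fun n => rp (f n) x).
    pose u := telescope (fun n => rp (f n) x).
    suff cu : cvgn (series u).
      rewrite (_ : (fun n => _) = (fun n => rp (f 0%N) x + series u n)).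
        by apply: is_cvgD => //; exact: is_cvg_cst.
      by apply/funext => n; exact: (eq_sum_telescope (fun n => rp (f n) x)).
    apply: normed_cvg.
    have -> : [normed series u] = (fun n => \sum_(0 <= i < n) D i x) by [].
    apply: nondecreasing_is_cvgn.
      by apply/nondecreasing_seqP => n; rewrite big_nat_recr//= lerDl -lee_fin D0.
    exists (fine (\sum_(n <oo) (D n x)%:E)%E) => _ [n _ <-].
    rewrite -lee_fin fineK// -sumEFin.
    exact: nneseries_lim_ge.
  have cvE : (rp (f n) x)%:E @[n --> \oo] --> (limn (fun n => rp (f n) x))%:E.
    by apply: cvg_EFin; [exact: nearW|exact: cv].
  rewrite /k (_ : limn_esup _ = (limn (fun n => rp (f n) x))%:E)//.
  rewrite is_cvg_limn_esupE; first exact/cvg_lim.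
  by apply/cvg_ex; eexists; exact: cvE.
have [kint cv _] := @dominated_convergence _ _ _ mu _ measurableT
  (fun n x => (rp (f n) x)%:E) (EFin \o k) G
  (fun n => (measurable_EFinP _ _).2 (measurable_repr (f n)))
  ((measurable_EFinP _ _).2 mk) (filterS (fun x h _ => h) fk) iG
  (aeW _ (fun x n _ => fG n x)).
have [g gk] := exists_Lspace1 kint.
exists g; first exact/Lspace_pred1P/Lspace1_integrable.
suff -> : (fun n => class_norm 1 (f n - (g : L0))%R) =
  (fun n => \int[mu]_x `|(rp (f n) x)%:E - (EFin \o k) x|)%E by exact: cv.
apply/funext => n.
rewrite (@class_norm1_ae _ (fun x => rp (f n) x - k x)) //.
  exact: measurable_funB.
by apply: filterS2 (reprB (f n) g) gk => x -> ->.
Qed.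

End classes.

(** * Riesz representation of the dual of L^1 *)

Section duality.
Context d (T : measurableType d) (R : realType).
Variable mu : {measure set T -> \bar R}.
Local Notation L0 := {mfun_ mu, T >-> measurableTypeR R}.
Local Notation rp := (@L0_repr d T R mu).
Local Notation L1 := (Lspace1 mu).
Local Notation Loo := (Lspaceoo mu).

Import HBSimple.

Lemma Lspace1_in (f : L1) : (f : L0) \in Lspace_pred mu 1%E.
Proof. exact/mem_set/Lebesgue_finite. Qed.

Lemma integrable_cst_indic (c : R) (E : set T) : measurable E -> (mu E < +oo)%E ->
  mu.-integrable [set: T] (EFin \o (fun x => c * \1_E x)).
Proof.
move=> mE Ey; apply: (@integrableZl _ _ _ mu _ measurableT c (fun x => (\1_E x)%:E)).
apply/integrableP; split; first exact/measurable_EFinP.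
rewrite (eq_integral (fun x => (\1_E x)%:E)) ?integral_indic ?setIT//.
by move=> x _; rewrite gee0_abs.
Qed.

Lemma integrable_fiber_lty (f : T -> R) (y : R) :
  mu.-integrable [set: T] (EFin \o f) -> y != 0 ->
  (mu (f @^-1` [set y]) < +oo)%E.
Proof.
move=> fi y0; have mf : measurable_fun [set: T] f.
  by apply/measurable_EFinP; exact: measurable_int fi.
have [n ny] : exists n : nat, n.+1%:R^-1 <= `|y| by apply: exists_natSinv_le;
  rewrite normr_gt0.
apply: le_lt_trans (integrable_level n fi).
apply: le_measure; rewrite ?inE; last by move=> x; rewrite /level /= => ->.
  by rewrite -[X in measurable X]setTI; apply: mf.
exact: measurable_level.
Qed.

(** Density of the integrable simple functions, as an induction principle: it serves both to
    approximate by bounded functions and to extend an identity between functionals. *)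
Lemma Lspace1_dense (P : L1 -> Prop) :
  (forall (c : R) (E : set T) (u : L1), measurable E -> (mu E < +oo)%E ->
    (\forall x \ae mu, rp u x = c * \1_E x) -> P u) ->
  (forall u v, P u -> P v -> P (u + v)) ->
  forall (g : L1) (e : R), 0 < e ->
    exists2 u, P u & (class_norm 1 ((g : L0) - (u : L0))%R <= e%:E)%E.
Proof.
move=> Pind PD g e e0.
have [s [si _ scv]] := approximation_sfun_integrable measurableT
  (Lspace1_integrable g).
have [n _ /(_ n (leqnn n)) /= sn] : \forall n \near \oo,
    (\int[mu]_z `|(rp g z)%:E - (s n z)%:E| < e%:E)%E.
  apply: (scv (fun z => z < e%:E)%E).
  by apply: open_nbhs_nbhs; split; [exact: open_ereal_lt_ereal|rewrite /= lte_fin].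
have step (r : seq R) : exists2 u, P u &
    \forall x \ae mu, rp u x = \sum_(y <- r) y * \1_(s n @^-1` [set y]) x.
  elim: r => [|y r [u Pu uE]].
    (* The empty sum is taken as 0 times the indicator of [set0], which spares a hypothesis
       [P 0]. *)
    have [u uE] := exists_Lspace1 (integrable_cst_indic 0 measurable0 (eq_ind_r
      (fun z => z < +oo)%E (ltry 0) (measure0 mu))).
    exists u; first by apply: (Pind 0 set0) => //; rewrite measure0.
    by apply: filterS uE => x ->; rewrite big_nil mul0r.
  (* The fibre over 0 may have infinite measure, but contributes nothing to the sum. *)
  pose E := if y == 0 then set0 else s n @^-1` [set y].
  have mE : measurable E by rewrite /E; case: ifP.
  have Ey : (mu E < +oo)%E.
    rewrite /E; case: ifPn => [_|y0]; first by rewrite measure0.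
    exact: integrable_fiber_lty (si n) y0.
  have [v vE] := exists_Lspace1 (integrable_cst_indic y mE Ey).
  exists (v + u); first by apply: PD => //; exact: Pind vE.
  apply: filterS3 (reprD v u) uE vE => x vux ux vx.
  rewrite big_cons -ux; transitivity (rp v x + rp u x); first exact: vux.
  rewrite vx; congr (_ + _); rewrite /E; case: ifPn => // /eqP ->.
  by rewrite !mul0r.
have [u Pu uE] := step (finmap.enum_fset (fset_set (range (s n)))).
exists u => //; apply/ltW; apply: le_lt_trans sn.
rewrite (@class_norm1_ae _ _ _ _ _ (fun x => rp g x - s n x)) //.
  exact: measurable_funB.
apply: filterS2 (reprB g u) uE => x -> ->; congr (_ - _).
by rewrite [RHS]fimfunE fsbig_finite.
Qed.

Lemma Lspace1_dense_bounded (g : L1) (e : R) : 0 < e ->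
  exists2 u : L1, (u : L0) \in Lspace_pred mu +oo%E &
    (class_norm 1 ((g : L0) - (u : L0))%R <= e%:E)%E.
Proof.
apply: Lspace1_dense => [c E u mE Ey uE|u v uoo voo].
  apply/Lspace_predooP; exists `|c| => //; apply: filterS uE => x ->.
  by rewrite normrM ler_piMr// indicE; case: (_ \in _); rewrite ?normr1 ?normr0.
by apply: (Lspace_predD (leey 1%E) uoo voo).
Qed.

(** The test function is the sign of [k] times the indicator of [E]. The sign is 1 at zeros of [k],
    so that [|u|] is exactly the indicator and the L^1 norm is [mu E]. *)
Lemma sign_class (k : L0) (E : set T) : measurable E -> (mu E < +oo)%E ->
  exists u : L1, [/\ (u : L0) \in Lspace_pred mu +oo%E,
    \forall x \ae mu, `|rp u x| <= 1,
    class_norm 1 u = mu E &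
    pairing u k = fine (\int[mu]_(x in E) `|rp k x|%:E)%E].
Proof.
move=> mE Ey.
pose s x : R := (if 0 <= rp k x then 1 else -1) * \1_E x.
have ms : measurable_fun [set: T] s.
  apply: measurable_funM => //; apply: measurable_fun_ifT => //.
  exact: measurable_fun_ler.
have ns x : `|s x| = \1_E x.
  by rewrite /s normrM; case: ifP; rewrite ?normrN normr1 mul1r ger0_norm.
have si : mu.-integrable [set: T] (EFin \o s).
  apply: le_integrable (integrable_cst_indic 1 mE Ey) => //.
    exact/measurable_EFinP.
  by move=> x _; rewrite /= mul1r !ns lee_fin ler_norm.
have [u us] := exists_Lspace1 si.
have u1 : \forall x \ae mu, `|rp u x| <= 1.
  by apply: filterS us => x ->; rewrite ns indicE; case: (_ \in _).
exists u; split => //.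
- by apply/Lspace_predooP; exists 1.
- rewrite (class_norm1_ae ms us); under eq_integral do rewrite ns.
  by rewrite integral_indic ?setIT.
- rewrite /pairing (@Rintegral_ae_eq _ _ _ _ _ (fun x => s x * rp k x)).
  + congr fine; rewrite [RHS]integral_mkcond; apply: eq_integral => x _.
    rewrite patchE /s indicE; case: (x \in E); last by rewrite mulr0 mul0r.
    rewrite mulr1; case: ifPn => kx; first by rewrite mul1r ger0_norm.
    by rewrite mulN1r ltr0_norm// ltNge.
  + by apply: measurable_funM; exact: measurable_repr.
  + by apply: measurable_funM => //; exact: measurable_repr.
  + by apply: filterS us => x ->.
Qed.

Hypothesis sf : semifinite_measure mu.

(** Testing against signs bounds the integral of [|k|] over every set of finite measure. The L^oo
    alternative is what later puts a Riesz density into L^1. *)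
Lemma Lspace1_dual_norm (k : L0) (C : R) :
  k \in Lspace_pred mu 1%E \/ k \in Lspace_pred mu +oo%E ->
  (forall u : L1, (u : L0) \in Lspace_pred mu +oo%E ->
     (\forall x \ae mu, `|rp u x| <= 1) -> pairing u k <= C) ->
  (class_norm 1 k <= C%:E)%E.
Proof.
move=> kp kC; rewrite class_norm1E; apply: semifinite_integral_le => //.
move=> E mE Ey; have [u [uoo u1 _ uE]] := sign_class k mE Ey.
have mk : measurable_fun E (fun x => `|rp k x|%:E).
  apply: measurable_funTS; apply/measurable_EFinP; exact: measurableT_comp.
(* Finiteness must be known beforehand: [pairing] goes through [fine], which sends [+oo] to 0. *)
have kfin : (\int[mu]_(x in E) `|rp k x|%:E)%E \is a fin_num.
  rewrite ge0_fin_numE ?integral_ge0//.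
  case: kp => [/Lspace_pred1P/integrableP[_]|/Lspace_predooP[D D0 kD]].
    apply: le_lt_trans; apply: ge0_subset_integral => //.
    by apply/measurable_EFinP; exact: measurableT_comp.
  apply: (@le_lt_trans _ _ (D%:E * mu E)%E); last exact: lte_mul_pinfty.
  rewrite -integral_cst//; apply: ae_ge0_le_integral => //.
  by apply: filterS kD => x kD _; rewrite lee_fin.
by rewrite -(fineK kfin) lee_fin -uE kC.
Qed.

Lemma Lspaceoo_dual_norm (h : Loo) (C : R) : 0 <= C ->
  (forall u : L1, (u : L0) \in Lspace_pred mu +oo%E ->
     (`|pairing h u|%:E <= C%:E * class_norm 1 u)%E) ->
  (class_norm +oo h <= C%:E)%E.
Proof.
move=> C0 hC; apply/class_normoo_leP => //; apply: semifinite_ae_le => //.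
move=> E mE Ey; have [u [uoo _ nu uE]] := sign_class h mE Ey.
have mk : measurable_fun E (fun x => `|rp h x|%:E).
  apply: measurable_funTS; apply/measurable_EFinP; exact: measurableT_comp.
have hfin : (\int[mu]_(x in E) `|rp h x|%:E)%E \is a fin_num.
  rewrite ge0_fin_numE ?integral_ge0//.
  have [D D0 hD] := Lspaceoo_bounded h.
  apply: (@le_lt_trans _ _ (D%:E * mu E)%E); last exact: lte_mul_pinfty.
  rewrite -integral_cst//; apply: ae_ge0_le_integral => //.
  by apply: filterS hD => x hD _; rewrite lee_fin.
rewrite -nu -(fineK hfin) -uE pairingC.
by apply: le_trans (hC u uoo); rewrite lee_fin ler_norm.
Qed.

Hypothesis dsp : direct_sum_property mu.

(** On indicators [phi] is a set function bounded by [C * mu], and [h] is its density. The identity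
    then holds on simple functions, and passes to L^1 because both sides are [C]-Lipschitz. *)
Lemma Lspace1_riesz (phi : L1 -> R) (C : R) : 0 <= C ->
  (forall f g, phi (f + g) = phi f + phi g) ->
  (forall a f, phi (a *: f) = a * phi f) ->
  (forall f, `|phi f|%:E <= C%:E * class_norm 1 f)%E ->
  exists2 h : Loo, (class_norm +oo h <= C%:E)%E & forall g : L1, phi g = pairing h g.
Proof.
move=> C0 phiD phiZ phiC.
have phi_ae (f g : L1) : (\forall x \ae mu, rp f x = rp g x) -> phi f = phi g.
  by move=> fg; congr phi; apply: val_inj; exact: repr_inj.
have ex (A : set T) : exists u : L1, measurable A -> (mu A < +oo)%E ->
    \forall x \ae mu, rp u x = 1 * \1_A x.
  have [[mA Ay]|nA] := pselect (measurable A /\ (mu A < +oo)%E).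
    by have [u uA] := exists_Lspace1 (integrable_cst_indic 1 mA Ay); exists u.
  by exists 0 => mA Ay; case: nA.
have [i iP] := choice ex.
have [||h [mh hC hP]] := @set_function_density _ _ _ mu (phi \o i) C _ _ dsp.
- move=> A B mA mB Ay By AB; rewrite /= -phiD; apply: phi_ae.
  have iAB := iP _ (measurableU _ _ mA mB) (measureU_lty mA mB Ay By).
  apply: filterS2 iAB (filterI (reprD (i A) (i B)) (filterI (iP _ mA Ay) (iP _ mB
    By))) => x -> [iD [iA iB]].
  transitivity (rp (i A) x + rp (i B) x); last exact/esym/iD.
  rewrite iA iB !mul1r !indicE in_setU.
  have : ~ (A x /\ B x) by move=> ABx; have : (A `&` B) x by []; rewrite AB.
  case: (boolP (x \in A)) => [/set_mem Ax|_];
    case: (boolP (x \in B)) => [/set_mem Bx|_] //= h.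
  + by case: h.
  + by rewrite addr0.
  + by rewrite add0r.
  + by rewrite addr0.
- move=> A mA Ay /=; have := phiC (i A).
  rewrite (class_norm1_ae _ (iP _ mA Ay)); last exact: measurable_funM.
  rewrite (eq_integral (fun x => (\1_A x)%:E)) ?integral_indic ?setIT//.
  by move=> x _; rewrite mul1r ger0_norm.
have [H Hh] := exists_Lspaceoo mh C0 hC.
exists H.
  by apply/class_normoo_leP => //; apply: filterS2 Hh hC => x ->.
have Hoo := Lspaceoo_in H.
have HC : \forall x \ae mu, `|rp H x| <= C by apply: filterS2 Hh hC => x ->.
move=> g; apply/eqP; rewrite -subr_eq0 -normr_le0.
apply/ler_addgt0Pr => e e0; rewrite add0r.
(* Each of the two functionals contributes [C] times the approximation error; the [+ 1] covers
   [C = 0]. *)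
have e1 : 0 < e / (2 * C + 1) by rewrite divr_gt0// ltr_wpDl// mulr_ge0.
have [||u uE gu] := @Lspace1_dense (fun u => phi u = pairing H u) _ _ g _ e1.
- move=> c E u mE Ey uE.
  have uc : u = c *: i E.
    apply: val_inj; apply: repr_inj.
    apply: filterS3 uE (reprZ c (i E)) (iP _ mE Ey) => x -> ciE iE.
    by rewrite [RHS]ciE iE mul1r.
  rewrite uc phiZ [RHS](pairingZr _ Hoo (Lspace1_in (i E))); congr (_ * _).
  have := (hP _ mE Ey).2; move=> /(congr1 fine) /= <-.
  rewrite /pairing (@Rintegral_ae_eq _ _ _ _ _ (fun x => h x * \1_E x)).
  + congr fine; rewrite [LHS]integral_mkcond; apply: eq_integral => x _.
    by rewrite patchE indicE; case: (_ \in _); rewrite ?mulr1 ?mulr0.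
  + by apply: measurable_funM; exact: measurable_repr.
  + exact: measurable_funM.
  + by apply: filterS2 Hh (iP _ mE Ey) => x -> ->; rewrite mul1r.
- move=> u v uE vE; rewrite phiD uE vE; symmetry.
  exact: (pairingDr Hoo (Lspace1_in u) (Lspace1_in v)).
have -> : phi g - pairing H g = phi (g - u) - pairing H (g - u)%R.
  have -> : pairing H (g - u)%R = pairing H g - pairing H u.
    exact: (pairingBr Hoo (Lspace1_in g) (Lspace1_in u)).
  have -> : phi (g - u) = phi g - phi u by rewrite phiD -scaleN1r phiZ mulN1r.
  by rewrite uE; ring.
apply: le_trans (ler_normB _ _) _.
rewrite -lee_fin EFinD.
have le1 := phiC (g - u).
have le2 := pairing_le C0 HC (Lspace1_in (g - u)).
apply: le_trans (leeD le1 le2) _.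
apply: (@le_trans _ _ (C%:E * (e / (2 * C + 1))%:E + C%:E * (e / (2 * C + 1))%:E)%E).
  by apply: leeD; apply: lee_wpmul2l => //; rewrite lee_fin.
rewrite -!EFinM -EFinD lee_fin.
have c1 : 0 < 2 * C + 1 by rewrite ltr_wpDl// mulr_ge0.
rewrite -mulrDl mulrA ler_pdivrMr// mulrC ler_pM2l//.
by rewrite mulr_natl mulr2n lerDl.
Qed.

End duality.

(** * The adjoint of an absolute contraction *)

Lemma half_expr_sum (R : realFieldType) (n : nat) :
  2^-1 ^+ n.+1 + 2^-1 ^+ n.+2 <= 2^-1 ^+ n :> R.
Proof.
have : 0 <= 2^-1 ^+ n :> R by rewrite exprn_ge0.
by rewrite !exprS; move: (2^-1 ^+ n) => x x0; lra.
Qed.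

Section adjoint.
Context d (Omega : measurableType d) (R : realType).
Variable mu : {measure set Omega -> \bar R}.
Local Notation L0 := {mfun_ mu, Omega >-> measurableTypeR R}.
Local Notation rp := (@L0_repr d Omega R mu).
Local Notation L1 := (Lspace1 mu).
Local Notation Loo := (Lspaceoo mu).
Local Notation inoo u := ((u : L0) \in Lspace_pred mu +oo%E).
Hypothesis dsp : direct_sum_property mu.

Let sf : semifinite_measure mu. Proof. by case: dsp. Qed.

Lemma pairing_inj (h h' : Loo) :
  (forall u : L1, inoo u -> pairing h u = pairing h' u) -> h = h'.
Proof.
move=> hh'; apply/eqP; rewrite -subr_eq0; apply/eqP; apply: val_inj.
apply: class_normoo_le0; apply: (Lspaceoo_dual_norm sf (h := h - h')) => // u uoo.
rewrite (_ : pairing _ _ = 0) ?normr0 ?mul0e//.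
rewrite [LHS](pairingBl (Lspaceoo_in h) (Lspaceoo_in h') (Lspace1_in u)).
by rewrite hh'// subrr.
Qed.

Variable T : {linear L1 -> L1}.
Hypothesis Tcontr : absolute_contraction T.

Lemma contraction_bound (u : L1) (C : R) : 0 <= C ->
  (\forall x \ae mu, `|rp u x| <= C) -> \forall x \ae mu, `|rp (T u) x| <= C.
Proof.
move=> C0 uC; apply/class_normoo_leP => //.
have uoo : inoo u by apply/Lspace_predooP; exists C.
by apply: le_trans (Tcontr.2 u uoo) _; apply/class_normoo_leP.
Qed.

Lemma contraction_oo (u : L1) : inoo u -> inoo (T u).
Proof.
move=> /Lspace_predooP[C C0 uC]; apply/Lspace_predooP; exists C => //.
exact: contraction_bound.
Qed.

(* [k] is T' g. *)
Definition adjoint (g k : L1) :=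
  forall u : L1, inoo u -> pairing (T u) g = pairing u k.

(** The L^oo bound on [T] keeps the image of a test function bounded by 1 within the same bound. As
    this holds for any adjoint pair, it gives both uniqueness of the adjoint and the Cauchy estimate
    for approximations. *)
Lemma adjoint_norm (g k : L1) : adjoint g k ->
  (class_norm 1 k <= class_norm 1 g)%E.
Proof.
move=> gk; rewrite -(fineK (class_norm1_fin g)).
apply: (Lspace1_dual_norm sf); first by left; exact: Lspace1_in.
move=> u uoo u1; rewrite -gk// -lee_fin (fineK (class_norm1_fin g)) -[leRHS]mul1e.
apply: le_trans (pairing_le ler01 (contraction_bound ler01 u1) (Lspace1_in g)).
by rewrite lee_fin ler_norm.
Qed.

Lemma adjointD (g g' k k' : L1) : adjoint g k -> adjoint g' k' ->
  adjoint (g + g') (k + k').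
Proof.
move=> gk gk' u uoo.
rewrite [LHS](pairingDr (contraction_oo uoo) (Lspace1_in g) (Lspace1_in g')).
by rewrite [RHS](pairingDr uoo (Lspace1_in k) (Lspace1_in k')) gk// gk'.
Qed.

Lemma adjointZ (a : R) (g k : L1) : adjoint g k -> adjoint (a *: g) (a *: k).
Proof.
move=> gk u uoo.
rewrite [LHS](pairingZr a (contraction_oo uoo) (Lspace1_in g)).
by rewrite [RHS](pairingZr a uoo (Lspace1_in k)) gk.
Qed.

Lemma adjointB (g g' k k' : L1) : adjoint g k -> adjoint g' k' ->
  adjoint (g - g') (k - k').
Proof.
move=> gk gk' u uoo.
rewrite [LHS](pairingBr (contraction_oo uoo) (Lspace1_in g) (Lspace1_in g')).
by rewrite [RHS](pairingBr uoo (Lspace1_in k) (Lspace1_in k')) gk// gk'.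
Qed.

Lemma adjoint_unique (g k k' : L1) : adjoint g k -> adjoint g k' -> k = k'.
Proof.
move=> gk gk'; apply/eqP; rewrite -subr_eq0; apply/eqP; apply: val_inj.
apply: class_norm1_le0; apply: le_trans (adjoint_norm (adjointB gk gk')) _.
rewrite subrr (class_norm1_ae _ (repr0 mu))//.
by under eq_integral do rewrite normr0; rewrite integral0.
Qed.

Lemma adjoint_bounded_ex (g : L1) : inoo g -> exists k, adjoint g k.
Proof.
move=> goo; have /Lspace_predooP[C C0 gC] := goo.
have [| | |h _ hP] := Lspace1_riesz dsp (phi := fun u => pairing g (T u)) C0.
- move=> u v; rewrite linearD;
  exact: (pairingDr goo (Lspace1_in (T u)) (Lspace1_in (T v))).
- move=> a u; rewrite linearZ; exact: (pairingZr a goo (Lspace1_in (T u))).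
- move=> u; apply: le_trans (pairing_le C0 gC (Lspace1_in (T u))) _.
  by apply: lee_wpmul2l; [rewrite lee_fin|exact: Tcontr.1].
have hE (u : L1) : inoo u -> pairing (T u) g = pairing u h.
  by move=> uoo; rewrite pairingC hP pairingC.
have h1 : (class_norm 1 h <= class_norm 1 g)%E.
  rewrite -(fineK (class_norm1_fin g)).
  apply: (Lspace1_dual_norm sf); first by right; exact: Lspaceoo_in.
  move=> u uoo u1; rewrite -hE// -lee_fin (fineK (class_norm1_fin g)) -[leRHS]mul1e.
  apply: le_trans (pairing_le ler01 (contraction_bound ler01 u1) (Lspace1_in g)).
  by rewrite lee_fin ler_norm.
have hin : (h : L0) \in Lspace_pred mu 1%E.
  apply/mem_set; apply: le_lt_trans h1 _; exact: Lebesgue_finite.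
by exists (Lspace_Sub (lexx 1%E) hin).
Qed.

Lemma adjoint_ex (g : L1) : exists k, adjoint g k.
Proof.
have e0 n : 0 < 2^-1 ^+ n.+1 :> R by rewrite exprn_gt0.
(* With errors 2^-(n+1), consecutive approximations differ by at most 2^-n, the rate that
   [Lspace1_complete] asks for. *)
have /choice[G /all_and2[Goo gG]] (n : nat) : exists u : L1, inoo u /\
    (class_norm 1 ((g : L0) - (u : L0))%R <= (2^-1 ^+ n.+1)%:E)%E.
  by have [u] := Lspace1_dense_bounded g (e0 n); exists u.
have /choice[K GK] n := adjoint_bounded_ex (Goo n).
have [|n|k' k'1 cv] := @Lspace1_complete _ _ _ mu (fun n => (K n : L0)).
- by move=> n; exact: Lspace1_in.
- apply: le_trans (adjoint_norm (adjointB (GK n.+1) (GK n))) _.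
  have -> : (G n.+1 - G n : L1) = ((g : L0) - (G n : L0)) - ((g : L0) - (G n.+1 :
    L0)) :> L0.
    by rewrite opprB [RHS]addrC [RHS]addrA subrK.
  apply: le_trans (class_norm1D _ _) _; rewrite class_norm1N.
  apply: le_trans (leeD (gG n) (gG n.+1)) _; rewrite -EFinD lee_fin.
  exact: half_expr_sum.
pose k : L1 := Lspace_Sub (lexx 1%E) k'1.
exists k => u uoo; have /Lspace_predooP[C C0 uC] := uoo.
apply/eqP; rewrite -subr_eq0 -normr_le0 -lee_fin.
(* The two terms bound the error of replacing [g] by [G n] and [k] by [K n], for which the adjoint
   identity is exact. *)
pose r n := (C%:E * (2^-1 ^+ n.+1)%:E + C%:E * class_norm 1 ((K n : L0) - (k :
  L0))%R)%E.
have rcv : r n @[n --> \oo] --> 0%E.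
  rewrite -[X in _ --> X](adde0 0%E); apply: cvgeD => //.
    rewrite -[X in _ --> X](mule0 C%:E); apply: cvgeZl => //.
    have gcv : geometric (2^-1 : R) 2^-1 @ \oo --> 0.
      by apply: cvg_geometric; rewrite ger0_norm// invf_lt1// ltr1n.
    have -> : (fun n => (2^-1 ^+ n.+1)%:E) = EFin \o geometric (2^-1 : R) 2^-1.
      by apply/funext => n; rewrite /= exprS.
    by apply: cvg_EFin; [exact: nearW|exact: gcv].
  by rewrite -[X in _ --> X](mule0 C%:E); exact: cvgeZl.
apply: cvge_to_ge rcv _; apply: nearW => n.
have -> : pairing (T u) g - pairing u k =
    pairing (T u) (g - G n)%R + pairing u (K n - k)%R.
  rewrite (pairingBr uoo (Lspace1_in (K n)) (Lspace1_in k)).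
  rewrite (pairingBr (contraction_oo uoo) (Lspace1_in g) (Lspace1_in (G n))).
  by rewrite (GK n u uoo) addrA subrK.
apply: (@le_trans _ _ (`|pairing (T u) (g - G n)%R|%:E + `|pairing u (K n -
  k)%R|%:E)%E).
  by rewrite -EFinD lee_fin ler_normD.
apply: leeD; last exact: (pairing_le C0 uC (Lspace1_in (K n - k))).
apply: le_trans (pairing_le C0 (contraction_bound C0 uC) (Lspace1_in (g - G n))) _.
by apply: lee_wpmul2l; [rewrite lee_fin|exact: gG].
Qed.

(** T' is linear since adjoints are unique, so Riesz representation applies to [g |-> <f, T' g>].
    [T'] stays in the statement because weak continuity of [S] is read off from the formula through
    it. *)
Lemma adjoint_oo_ex : exists (T' : L1 -> L1) (S : Loo -> Loo),
  [/\ forall g, adjoint g (T' g),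
    forall (f : Loo) (g : L1), pairing (S f) g = pairing f (T' g),
    forall f, (class_norm +oo (S f) <= class_norm +oo f)%E,
    forall a f f', S (a *: f + f') = a *: S f + S f' &
    forall (u : L1) (v : Loo), (u : L0) = (v : L0) -> (T u : L0) = (S v : L0)].
Proof.
have [T' T'P] := choice adjoint_ex.
have T'D g g' : T' (g + g') = T' g + T' g'.
  by apply: (adjoint_unique (T'P _)); exact: adjointD.
have T'Z a g : T' (a *: g) = a *: T' g.
  by apply: (adjoint_unique (T'P _)); exact: adjointZ.
have ex (f : Loo) : exists h : Loo, (class_norm +oo h <= class_norm +oo f)%E /\
    forall g : L1, pairing h g = pairing f (T' g).
  have f0 : 0 <= fine (class_norm +oo f) by rewrite fine_ge0// class_norm_ge0.
  have fC : \forall x \ae mu, `|rp f x| <= fine (class_norm +oo f).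
    by apply/class_normoo_leP; rewrite ?(fineK (class_normoo_fin f)).
  have foo := Lspaceoo_in f.
  have [| | |h hC hP] := Lspace1_riesz dsp (phi := fun g => pairing f (T' g)) f0.
  - by move=> g g'; rewrite T'D;
    exact: (pairingDr foo (Lspace1_in (T' g)) (Lspace1_in (T' g'))).
  - by move=> a g; rewrite T'Z; exact: (pairingZr a foo (Lspace1_in (T' g))).
  - move=> g; apply: le_trans (pairing_le f0 fC (Lspace1_in (T' g))) _.
    by apply: lee_wpmul2l; [rewrite lee_fin|exact: adjoint_norm].
  exists h; split; last by move=> g; rewrite hP.
  by rewrite -(fineK (class_normoo_fin f)).
have [S /all_and2[Sn SP]] := choice ex.
exists T', S; split => //.
- move=> a f f'; apply: pairing_inj => u _; rewrite SP.
  have foo := Lspaceoo_in f; have f'oo := Lspaceoo_in f'.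
  rewrite [LHS](pairingDl (Lspace_predZ a (leey 1%E) foo) f'oo (Lspace1_in (T' u))).
  rewrite [RHS](pairingDl (Lspace_predZ a (leey 1%E) (Lspaceoo_in (S f)))
    (Lspaceoo_in (S f')) (Lspace1_in u)).
  rewrite [in LHS](pairingZl a foo (Lspace1_in (T' u))).
  by rewrite [in RHS](pairingZl a (Lspaceoo_in (S f)) (Lspace1_in u)) !SP.
- move=> u v uv; have uoo : inoo u by rewrite uv; exact: Lspaceoo_in.
  (* On the intersection [T u] is itself bounded, so it can be compared with [S v] by pairing: both
     give [<u, T' g>]. *)
  pose w : Loo := Lspace_Sub (leey 1%E) (contraction_oo uoo).
  have -> : (T u : L0) = (w : L0) by [].
  suff -> : w = S v by [].
  apply: pairing_inj => g _.
  by rewrite SP -uv -(T'P g u uoo).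
Qed.

End adjoint.

(** * The weak topology *)

Section weak_topology.
Context d (Omega : measurableType d) (R : realType).
Variable mu : {measure set Omega -> \bar R}.
Local Notation L0 := {mfun_ mu, Omega >-> measurableTypeR R}.
Local Notation rp := (@L0_repr d Omega R mu).
Local Notation L1 := (Lspace1 mu).
Local Notation Loo := (Lspaceoo mu).

Lemma weak_cvgP (F : set_system Loo) (f : Loo) : Filter F ->
  F --> (f : Lspaceoo_weak mu) <->
  forall g : L1, (fun h : Loo => pairing h g) @ F --> pairing f g.
Proof.
move=> FF; split=> [Ff g|Ff].
  apply: (@cvg_trans _ (pairing f' g @[f' --> (f : Lspaceoo_weak mu)])).
    by move=> A fA; exact: Ff.
  have c1 := @initial_continuous _ _ (@duality_pairing _ _ _ mu : Loo -> {ptws L1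
    -> R}) f.
  have c2 := @proj_continuous _ (fun=> R) g (duality_pairing f).
  exact: (cvg_comp _ _ c1 c2).
have Ff' : ((@duality_pairing _ _ _ mu : Loo -> {ptws L1 -> R}) @ F) -->
    (duality_pairing f : {ptws L1 -> R}).
  apply/cvg_sup => g A [_ [[B oB <-] Bf] BA]; apply: filterS BA _.
  by apply: (Ff g); exact: open_nbhs_nbhs.
move=> A [_ [[B oB <-] Bf] BA]; apply: filterS BA _.
by apply: Ff'; exact: open_nbhs_nbhs.
Qed.

(** The net of truncations [f 1_E], with [E] of finite measure directed by inclusion, encoded as a
    filter. A sequence need not be enough, as [mu] may fail to be sigma-finite. *)
Definition truncations (f : Loo) : set_system Loo :=
  filter_from [set E | measurable E /\ (mu E < +oo)%E]
    (fun E0 => [set f' : Loo | exists E, [/\ measurable E, (mu E < +oo)%E, E0 `<=`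
      E &
       \forall x \ae mu, rp f' x = rp f x * \1_E x]]).

Lemma truncation_ex (f : Loo) (E : set Omega) : measurable E ->
  exists f' : Loo, \forall x \ae mu, rp f' x = rp f x * \1_E x.
Proof.
move=> mE; have [C C0 fC] := Lspaceoo_bounded f.
apply: (@exists_Lspaceoo _ _ _ _ _ C) => //.
  by apply: measurable_funM => //; exact: measurable_repr.
apply: filterS fC => x fC; rewrite normrM indicE.
by case: (_ \in _); rewrite ?normr1 ?mulr1 ?normr0 ?mulr0.
Qed.

#[global] Instance truncations_filter (f : Loo) : ProperFilter (truncations f).
Proof.
apply: filter_from_proper; last first.
  move=> E [mE Ey]; have [f' f'E] := truncation_ex f mE.
  by exists f', E; split.
apply: filter_from_filter; first by exists set0; split=> //; rewrite measure0.
move=> E E' [mE Ey] [mE' E'y]; exists (E `|` E').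
  by split; [exact: measurableU|exact: measureU_lty].
move=> f' [D [mD Dy + f'D]]; rewrite subUset => -[ED E'D].
by split; exists D; split.
Qed.

Lemma truncation_Lspace1 (f f' : Loo) (E : set Omega) : measurable E ->
  (mu E < +oo)%E -> (\forall x \ae mu, rp f' x = rp f x * \1_E x) ->
  exists u : L1, (u : L0) = (f' : L0).
Proof.
move=> mE Ey f'E; have [C C0 fC] := Lspaceoo_bounded f.
have [||fi _] := @integrableM_ae _ _ _ mu (rp f) (fun x => 1 * \1_E x) C _ fC C0.
- exact: measurable_repr.
- exact: integrable_cst_indic.
have f'1 : (f' : L0) \in Lspace_pred mu 1%E.
  apply/Lspace_pred1P; apply: integrable_ae_eq fi; first exact: measurable_repr.
  by apply: filterS f'E => x ->; rewrite mul1r.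
by exists (Lspace_Sub (lexx 1%E) f'1).
Qed.

(** The error [<f, g> - <f 1_E, g>] is the pairing of [f] with [g] cut off outside [E], at most [C]
    times the mass of [g] off [E0]. *)
Lemma truncations_cvg (f : Loo) : truncations f --> (f : Lspaceoo_weak mu).
Proof.
apply/weak_cvgP => g; apply/cvgrPdist_le => e e0.
have [C C0 fC] := Lspaceoo_bounded f.
have e1 : 0 < e / (C + 1) by rewrite divr_gt0// ltr_wpDl.
have [E0 [mE0 E0y gE0]] := tail_integrable (Lspace1_integrable g) e1.
exists E0; first by split.
move=> f' [E [mE Ey E0E f'E]] /=.
have /integrableP[/measurable_EFinP mg gy] := Lspace1_integrable g.
pose t x := rp g x * \1_(~` E) x.
have mt : measurable_fun [set: Omega] t.
  by apply: measurable_funM => //; apply: measurable_indic; exact: measurableC.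
have tle : (\int[mu]_x `|t x|%:E <= (e / (C + 1))%:E)%E.
  apply: le_trans (ltW gE0); rewrite [leRHS]integral_mkcond.
  apply: ge0_le_integral => //.
  - by apply/measurable_EFinP; exact: measurableT_comp.
  - apply/(measurable_restrictT _ (measurableC mE0)).
    by apply: measurable_funTS; apply/measurable_EFinP; exact: measurableT_comp.
  - move=> x _; rewrite patchE /t indicE.
    have [/set_mem nE|_] := boolP (x \in ~` E); last first.
      by rewrite mulr0 normr0; case: ifP => _; [rewrite lee_fin|exact: lexx].
    by rewrite mulr1 ifT//; apply/mem_set => /E0E.
have ti : mu.-integrable [set: Omega] (EFin \o t).
  apply/integrableP; split; first exact/measurable_EFinP.
  by apply: le_lt_trans tle _; exact: ltry.
have [v vt] := exists_Lspace1 ti.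
have -> : pairing f g - pairing f' g = pairing f v.
  rewrite -(pairingBl (Lspaceoo_in f) (Lspaceoo_in f') (Lspace1_in g)).
  apply: Rintegral_ae_eq.
  - by apply: measurable_funM; exact: measurable_repr.
  - by apply: measurable_funM; exact: measurable_repr.
  - apply: filterS3 (reprB f f') f'E vt => x -> -> ->.
    rewrite /t !indicE in_setC; case: (x \in E) => /=.
      by rewrite mulr1 subrr mul0r !mulr0.
    by rewrite mulr0 subr0 mulr1.
rewrite -lee_fin; apply: le_trans (pairing_le C0 fC (Lspace1_in v)) _.
rewrite (class_norm1_ae mt vt).
apply: (@le_trans _ _ (C%:E * (e / (C + 1))%:E)%E).
  by apply: lee_wpmul2l; rewrite ?lee_fin.
have C1 : 0 < C + 1 by rewrite ltr_wpDl.
by rewrite -EFinM lee_fin mulrA ler_pdivrMr// mulrC ler_pM2l// lerDl.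
Qed.

End weak_topology.

(** * Existence and uniqueness *)

Lemma linear_of (R : pzRingType) (U V : lmodType R) (f : U -> V) :
  linear f -> exists L : {linear U -> V}, L =1 f.
Proof.
move=> lf; pose fL := GRing.isLinear.Build R U V *:%R f lf.
pose L : {linear U -> V} := HB.pack f fL.
by exists L.
Qed.

Lemma subr_cross (V : zmodType) (a b c e : V) : a + c = b + e -> a - b = e - c.
Proof. by move=> h; rewrite -[a](addrK c) h addrAC (addrC b) addrK. Qed.

Lemma addr_cross (V : zmodType) (a b c e : V) : a - b = e - c -> a + c = b + e.
Proof. by move=> h; rewrite -[a](subrK b) h addrAC subrK addrC. Qed.

Section extension.
Context d (Omega : measurableType d) (R : realType).
Variable mu : {measure set Omega -> \bar R}.
Local Notation L0 := {mfun_ mu, Omega >-> measurableTypeR R}.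
Local Notation rp := (@L0_repr d Omega R mu).
Local Notation L1 := (Lspace1 mu).
Local Notation Loo := (Lspaceoo mu).
Local Notation Lsum := (Lspace_sum mu).

Lemma Lspace_sum_ex (x : Lsum) :
  exists gh : L1 * Loo, x = Lspace1_sum gh.1 + Lspaceoo_sum gh.2.
Proof.
have [g [h xE]] := set_mem (valP x); exists (g, h).
by apply: val_inj; exact: xE.
Qed.

Variables (T : {linear L1 -> L1}) (S : Loo -> Loo).
Hypothesis SL : forall a f f', S (a *: f + f') = a *: S f + S f'.
Hypothesis TS : forall (u : L1) (v : Loo), (u : L0) = (v : L0) -> (T u : L0) = (S v
  : L0).

(** Two decompositions of a class differ by an element of L^1 /\ L^oo, where [T] and [S] agree, so
    [T g + S h] does not depend on the choice [c]. Linearity follows, since linear combinations of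
    decompositions are decompositions. *)
Lemma Lspace_sum_extension : exists L : {linear Lsum -> Lsum},
  (forall g, L (Lspace1_sum g) = Lspace1_sum (T g)) /\
  (forall h, L (Lspaceoo_sum h) = Lspaceoo_sum (S h)).
Proof.
have [c cE] := choice Lspace_sum_ex.
pose F (gh : L1 * Loo) : Lsum := Lspace1_sum (T gh.1) + Lspaceoo_sum (S gh.2).
have SB (f f' : Loo) : S (f - f') = S f - S f'.
  by rewrite -scaleN1r addrC SL scaleN1r addrC.
have Fwd (g g' : L1) (h h' : Loo) : (g : L0) + (h : L0) = (g' : L0) + (h' : L0) ->
    F (g, h) = F (g', h').
  move=> gh; apply: val_inj.
  have e : ((g - g' : L1) : L0) = ((h' - h : Loo) : L0).
    change ((g : L0) - (g' : L0) = (h' : L0) - (h : L0)).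
    exact: subr_cross.
  have := TS e; rewrite linearB SB => {}e.
  change ((T g : L0) - (T g' : L0) = (S h' : L0) - (S h : L0)) in e.
  change ((T g : L0) + (S h : L0) = (T g' : L0) + (S h' : L0)).
  exact: addr_cross.
have vE (x : Lsum) : (x : L0) = ((c x).1 : L0) + ((c x).2 : L0) by exact: (congr1
  val (cE x)).
have lF : linear (F \o c).
  move=> a x y; rewrite /=.
  have -> : a *: F (c x) + F (c y) =
      F (a *: (c x).1 + (c y).1, a *: (c x).2 + (c y).2).
    apply: val_inj; rewrite /F /= linearP SL.
    change (a *: ((T (c x).1 : L0) + (S (c x).2 : L0)) +
            ((T (c y).1 : L0) + (S (c y).2 : L0)) =
            (a *: (T (c x).1 : L0) + (T (c y).1 : L0)) +
            (a *: (S (c x).2 : L0) + (S (c y).2 : L0))).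
    by rewrite scalerDr addrACA.
  rewrite [c (a *: x + y)]surjective_pairing; apply: Fwd; rewrite -vE.
  change (a *: (x : L0) + (y : L0) =
     (a *: ((c x).1 : L0) + ((c y).1 : L0)) + (a *: ((c x).2 : L0) + ((c y).2 :
       L0))).
  by rewrite (vE x) (vE y) scalerDr addrACA.
have S0 : S 0 = 0 by have := SB 0 0; rewrite !subrr.
have [L LE] := linear_of lF.
exists L; split => [g|h]; rewrite LE /= [c _]surjective_pairing.
- rewrite (@Fwd _ g _ 0); last first.
    by rewrite -vE; change ((g : L0) = (g : L0) + 0); rewrite addr0.
  apply: val_inj; rewrite /F /= S0.
  by change ((T g : L0) + 0 = (T g : L0)); rewrite addr0.
- rewrite (@Fwd _ 0 _ h); last first.
    by rewrite -vE; change ((h : L0) = 0 + (h : L0)); rewrite add0r.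
  apply: val_inj; rewrite /F /= linear0.
  by change (0 + (S h : L0) = (S h : L0)); rewrite add0r.
Qed.

End extension.

Section uniqueness.
Context d (Omega : measurableType d) (R : realType).
Variable mu : {measure set Omega -> \bar R}.
Local Notation L0 := {mfun_ mu, Omega >-> measurableTypeR R}.
Hypothesis dsp : direct_sum_property mu.

Lemma dunford_schwartz_unique (S S' : dunford_schwartz mu) :
  (forall g, S (Lspace1_sum g) = S' (Lspace1_sum g)) ->
  continuous (ds_restrict_oo S : Lspaceoo_weak mu -> Lspaceoo_weak mu) ->
  continuous (ds_restrict_oo S' : Lspaceoo_weak mu -> Lspaceoo_weak mu) ->
  S = S'.
Proof.
move=> SS' cS cS'.
have ooE (h : Lspaceoo mu) : S (Lspaceoo_sum h) = S' (Lspaceoo_sum h).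
  apply: val_inj; change (ds_restrict_oo S h = ds_restrict_oo S' h :> L0).
  suff -> : ds_restrict_oo S h = ds_restrict_oo S' h :> Lspaceoo mu by [].
  apply: (pairing_inj dsp) => g _.
  have cv (U : dunford_schwartz mu) :
      continuous (ds_restrict_oo U : Lspaceoo_weak mu -> Lspaceoo_weak mu) ->
      (fun f => pairing (ds_restrict_oo U f) g) @ truncations h -->
      pairing (ds_restrict_oo U h) g.
    move=> cU; have tU : ds_restrict_oo U @ truncations h -->
        (ds_restrict_oo U h : Lspaceoo_weak mu).
      by move=> A /(cU h) hA; exact: (@truncations_cvg _ _ _ _ h _ hA).
    exact: (weak_cvgP _ _).1 tU g.
  apply: (cvg_unique _ (cv S cS)) => //.
  apply: cvg_trans (cv S' cS'); apply: near_eq_cvg.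
  (* Every truncation lies in L^1, where the two operators agree, so the smallest index [set0]
     already works. *)
  exists set0; first by split => //; rewrite measure0.
  move=> f [E [mE Ey _ fE]].
  have [u uf] := truncation_Lspace1 mE Ey fE.
  have fu : Lspaceoo_sum f = Lspace1_sum u by apply: val_inj; rewrite /= uf.
  change (pairing (S' (Lspaceoo_sum f)) g = pairing (S (Lspaceoo_sum f)) g).
  by rewrite fu SS'.
apply: dunford_schwartz_ext => x; have [[g h] ->] := Lspace_sum_ex x.
by rewrite !linearD /= SS' ooE.
Qed.

End uniqueness.

Theorem theorem3p1 (R : realType) (d : measure_display) (Omega : measurableType d)
  (mu : {measure set Omega -> \bar R})
  (T : {linear Lspace1 mu -> Lspace1 mu}) :
  direct_sum_property mu -> absolute_contraction T ->
  exists! S : dunford_schwartz mu,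
    (forall f : Lspace1 mu, S (Lspace1_sum f) = Lspace1_sum (T f)) /\
    continuous (ds_restrict_oo S : Lspaceoo_weak mu -> Lspaceoo_weak mu).
Proof.
move=> dsp Tcontr.
have [T' [Soo [_ SooT' Soo_le SooL TSoo]]] := adjoint_oo_ex dsp Tcontr.
have [L [LT LSoo]] := Lspace_sum_extension SooL TSoo.
have L1 (f : Lspace1 mu) :
    (class_norm 1 (L (Lspace1_sum f)) <= class_norm 1 f)%E.
  by rewrite LT; exact: Tcontr.1.
have Loo (f : Lspaceoo mu) :
    (class_norm +oo (L (Lspaceoo_sum f)) <= class_norm +oo f)%E.
  by rewrite LSoo; exact: Soo_le.
pose S := DunfordSchwartz L1 Loo.
have cS : continuous (ds_restrict_oo S : Lspaceoo_weak mu -> Lspaceoo_weak mu).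
  move=> f; have FF : Filter (nbhs (f : Lspaceoo_weak mu)) by exact: nbhs_filter.
  apply: (@weak_cvgP _ _ _ mu (ds_restrict_oo S @ (f : Lspaceoo_weak mu)) _
    (fmap_filter _ FF)).2 => g.
  (* Pairing the image with [g] amounts to pairing [h] with the fixed element [T' g] of L^1, which
     is weakly continuous in [h] by definition. *)
  have SE (h : Lspaceoo mu) : pairing (ds_restrict_oo S h) g = pairing h (T' g).
    rewrite -SooT'; congr (pairing _ g).
    by change ((L (Lspaceoo_sum h) : {mfun_ mu, Omega >-> measurableTypeR R}) = Soo
      h); rewrite LSoo.
  rewrite SE.
  suff : (fun h => pairing (ds_restrict_oo S h) g) @ (f : Lspaceoo_weak mu) -->
    pairing f (T' g) by [].
  under eq_fun do rewrite SE.
  exact: (@weak_cvgP _ _ _ mu (nbhs (f : Lspaceoo_weak mu)) f FF).1.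
exists S; split=> [|S' [S'T cS']]; first by split.
by apply: (dunford_schwartz_unique dsp) => // g; rewrite S'T; exact: LT.
Qed.
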